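(* Let $\widetilde{\omega}=(3,3,2,1,1)$. There exist exactly $925$ admissible monomials of degree $5(2^1-1)+18\cdot2^1=41$ in $\mathcal P_5^{>0}$ (that is, admissible monomials $x_1^{t_1}\cdots x_5^{t_5}$ of $\mathcal P_5$ with all $t_j>0$) whose weight vector is $\widetilde\omega$. Consequently, the $\mathbb F_2$-vector space $(Q^{\otimes 5}_{41})^{\widetilde{\omega}^{>0}}$ has dimension $925$.
   Context: Let $\mathscr A$ be the mod 2 Steenrod algebra, $\overline{\mathscr A}$ its positive degree part, and $\mathcal P_m=\mathbb F_2[x_1,\dots,x_m]$ with $\deg x_i=1$, viewed as an $\mathscr A$-module via $Sq^0(x_i)=x_i$, $Sq^1(x_i)=x_i^2$, $Sq^j(x_i)=0$ for $j>1$, and the Cartan formula. For homogeneous $F,G\in\mathcal P_m$ of the same degree, $F\equiv G$ means $F-G\in\overline{\mathscr A}\mathcal P_m$. A weight vector is a sequence $\omega=(\omega_1,\omega_2,\dots)$ of non-negative integers with $\omega_t=0$ for $t\gg0$ (trailing zeros are omitted); its degree is $\deg\omega=\sum_{t\ge1}2^{t-1}\omega_t$. For a monomial $X=x_1^{u_1}\cdots x_m^{u_m}$, its weight vector $\omega(X)$ has $\omega_t(X)=\sum_{j}\alpha_{t-1}(u_j)$, where $\alpha_s(u)$ is the coefficient of $2^s$ in the binary expansion of $u$, and its exponent vector is $u(X)=(u_1,\dots,u_m)$. Both kinds of vectors are ordered left-lexicographically. For monomials $X,Y$ of the same degree, $X<Y$ iff $\omega(X)<\omega(Y)$, or $\omega(X)=\omega(Y)$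 and $u(X)<u(Y)$. A monomial $X$ is inadmissible if there are monomials $Y_1,\dots,Y_k$ with $Y_j<X$ for all $j$ and $X\equiv\sum_j Y_j$ (the empty sum, i.e. $X\equiv 0$, being allowed); otherwise $X$ is admissible. $\mathcal P_m^{>0}$ is the span of the monomials $\prod_jx_j^{t_j}$ with all $t_j>0$. Let $\mathcal P_m^{\le\omega}$ (resp. $\mathcal P_m^{<\omega}$) be the span of the monomials $X$ with $\deg X=\deg\omega$ and $\omega(X)\le\omega$ (resp. $\omega(X)<\omega$), and put $$(Q^{\otimes m})^\omega=\mathcal P_m^{\le\omega}/\big((\overline{\mathscr A}\mathcal P_m\cap\mathcal P_m^{\le\omega})+\mathcal P_m^{<\omega}\big).$$ For $\deg\omega=n$, $(Q^{\otimes m}_n)^{\omega^{>0}}$ denotes the subspace of $(Q^{\otimes m})^{\omega}$ spanned by the classes of monomials in $\mathcal P_m^{\le\omega}\cap\mathcal P_m^{>0}$. *)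

(* Defs.v *)
From HB Require Import structures.
From mathcomp Require Import all_boot all_order all_algebra.
From mathcomp Require Import generic_quotient ring_quotient boolp mpoly.
Set Implicit Arguments. Unset Strict Implicit. Unset Printing Implicit Defensive.
Import Order.TTheory GRing.Theory.
Local Open Scope ring_scope.
Local Open Scope quotient_scope.

Section Span.
Variables (K : fieldType) (V : lmodType K).
Implicit Types (S : V -> Prop) (u v : V).

Definition lspan S v : Prop :=
  exists (n : nat) (c : 'I_n -> K) (f : 'I_n -> V),
    (forall i, S (f i)) /\ v = \sum_(i < n) c i *: f i.

Lemma span0 S : lspan S 0.
Proof.
exists 0%N, (fun=> 0), (fun=> 0); split; first by case.
by rewrite big_ord0.
Qed.

Lemma spanP S a u v : lspan S u -> lspan S v -> lspan S (a *: u + v).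
Proof.
move=> [m [c [f [Sf ->]]]] [n [d [g [Sg ->]]]].
exists (m + n)%N,
  (fun k => match split k with inl i => a * c i | inr j => d j end),
  (fun k => match split k with inl i => f i | inr j => g j end).
split=> [k|]; first by case: (split k).
rewrite big_split_ord /= scaler_sumr; congr (_ + _); apply: eq_bigr => i _.
  by rewrite (unsplitK (inl i)) scalerA.
by rewrite (unsplitK (inr i)).
Qed.

Definition in_span S : {pred V} := fun v => `[< lspan S v >].

Lemma in_spanP S v : reflect (lspan S v) (v \in in_span S).
Proof. exact: asboolP. Qed.

Lemma in_span_submod S : submod_closed (in_span S).
Proof.
split=> [|a u v /in_spanP Su /in_spanP Sv]; apply/in_spanP; first exact: span0.
exact: spanP.
Qed.

HB.instance Definition _ S :=
  GRing.isSubmodClosed.Build K V (in_span S) (in_span_submod S).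

Record subspace S :=
  Subspace { subspace_val :> V; _ : subspace_val \in in_span S }.

HB.instance Definition _ S := [isSub for @subspace_val S].
HB.instance Definition _ S := [Choice of subspace S by <:].
HB.instance Definition _ S := [SubChoice_isSubZmodule of subspace S by <:].
HB.instance Definition _ S := [SubZmodule_isSubLmodule of subspace S by <:].

(* V / lspan S *)
Definition lquotient S := Quotient.quot (in_span S).
HB.instance Definition _ S := GRing.Zmodule.on (lquotient S).
HB.instance Definition _ S := EqQuotient.on (lquotient S).

Definition quotient_class S (v : V) : lquotient S := \pi_(lquotient S) v.

Lemma quotient_classP S u v :
  quotient_class S u = quotient_class S v <-> lspan S (u - v).
Proof.
split=> [uv|/in_spanP]; last by rewrite (Quotient.idealrBE (in_span S)) => /eqP.
by apply/in_spanP; rewrite (Quotient.idealrBE (in_span S)); apply/eqP.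
Qed.

Lemma quotient_classD S u v :
  quotient_class S (u + v) = quotient_class S u + quotient_class S v.
Proof. exact: (raddfD (\pi_(Quotient.quot (in_span S)))). Qed.

Lemma quotient_class_repr S (x : lquotient S) : quotient_class S (repr x) = x.
Proof. exact: reprK. Qed.

Definition quotient_scale S (a : K) (x : lquotient S) : lquotient S :=
  quotient_class S (a *: repr x).

Lemma quotient_scaleE S a v :
  quotient_scale a (quotient_class S v) = quotient_class S (a *: v).
Proof.
apply/quotient_classP; rewrite -scalerBr -[_ *: _]addr0.
by apply: spanP (span0 S); apply/quotient_classP/quotient_class_repr.
Qed.

Fact quotient_scaleA S a b (x : lquotient S) :
  quotient_scale a (quotient_scale b x) = quotient_scale (a * b) x.
Proof.
by rewrite -[x]quotient_class_repr !quotient_scaleE scalerA.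
Qed.

Fact quotient_scale1 S : left_id 1 (@quotient_scale S).
Proof. by move=> x; rewrite -[x]quotient_class_repr quotient_scaleE scale1r. Qed.

Fact quotient_scaleDr S : right_distributive (@quotient_scale S) +%R.
Proof.
move=> a x y; rewrite -[x]quotient_class_repr -[y]quotient_class_repr.
by rewrite -quotient_classD !quotient_scaleE scalerDr quotient_classD.
Qed.

Fact quotient_scaleDl S (x : lquotient S) :
  {morph (@quotient_scale S)^~ x : a b / a + b}.
Proof.
move=> a b; rewrite -[x]quotient_class_repr !quotient_scaleE.
by rewrite scalerDl quotient_classD.
Qed.

HB.instance Definition _ S := GRing.Zmodule_isLmodule.Build K (lquotient S)
  (@quotient_scaleA S) (@quotient_scale1 S) (@quotient_scaleDr S)
  (@quotient_scaleDl S).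

Definition has_dim (n : nat) : Prop := inhabited (Vector.axiom n V).

End Span.

Arguments has_dim {K} V n.

Section Steenrod.
Variable m : nat.
Local Notation P := {mpoly 'F_2[m]}.
Implicit Types (F G : P) (X Y : 'X_{1..m}).

(* The total square: the ring morphism P -> P[T] with x_i |-> x_i + x_i^2 T.
   Its coefficient of T^k is Sq^k; lemmas Sq_X, Sq_Cartan and SqD below
   are the axioms that determine the action. *)
Definition total_square F : {poly P} :=
  mmap (polyC \o @mpolyC m 'F_2)
       (fun i => ('X_i)%:P + ('X_i ^+ 2)%:P * 'X) F.

Definition Sq (k : nat) F : P := (total_square F)`_k.

Lemma SqD k F G : Sq k (F + G) = Sq k F + Sq k G.
Proof. by rewrite /Sq /total_square mmapD coefD. Qed.

Lemma Sq_X k (i : 'I_m) :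
  Sq k ('X_i : P) = match k with 0 => 'X_i | 1 => 'X_i ^+ 2 | _ => 0 end.
Proof.
rewrite /Sq /total_square mmapX mmap1U coefD coefMX !coefC.
by case: k => [|[|k]] /=; rewrite ?coefC /= ?addr0 ?add0r.
Qed.

Lemma Sq_1 k : Sq k (1 : P) = (k == 0%N)%:R.
Proof. by rewrite /Sq /total_square rmorph1 coef1. Qed.

Lemma Sq_Cartan k F G :
  Sq k (F * G) = \sum_(i < k.+1) Sq i F * Sq (k - i) G.
Proof. by rewrite /Sq /total_square rmorphM coefM. Qed.

(* The positive degree part of the Steenrod algebra is spanned by the
   composites Sq^(i_1) ... Sq^(i_r) with i_1 + ... + i_r > 0. *)
Definition hit : P -> Prop :=
  lspan (fun F => exists (s : seq nat) G, (0 < sumn s)%N /\ F = foldr Sq G s).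

Definition hit_equiv F G : Prop := hit (F - G).

Definition lexlt (d : Order.disp_t) (I : porderType d) (f g : I -> nat) : Prop :=
  exists i, (forall j, (j < i)%O -> f j = g j) /\ (f i < g i)%N.

(* Weight vectors are indexed from 0: weight X t is omega_(t+1)(X). *)
Definition weight X (t : nat) : nat := \sum_(j < m) odd (X j %/ 2 ^ t).

Definition monom_lt X Y : Prop :=
  mdeg X = mdeg Y /\
  (lexlt (weight X) (weight Y) \/
   weight X =1 weight Y /\ lexlt (fun i => X i) (fun i => Y i)).

Definition inadmissible X : Prop :=
  exists s : seq 'X_{1..m},
    (forall Y, Y \in s -> monom_lt Y X) /\
    hit_equiv 'X_[X] (\sum_(Y <- s) 'X_[Y]).

Definition admissible X : Prop := ~ inadmissible X.

Definition positive_monom X : Prop := forall j, (0 < X j)%N.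

(* A weight vector omega is given by a finite sequence, read as 0 beyond its
   end. *)
Definition wvec (omega : seq nat) (t : nat) : nat := nth 0%N omega t.

Definition wdeg (omega : seq nat) : nat :=
  \sum_(t < size omega) 2 ^ t * wvec omega t.

Definition monoms_le omega F : Prop :=
  exists X, [/\ F = 'X_[X], mdeg X = wdeg omega &
    lexlt (weight X) (wvec omega) \/ weight X =1 wvec omega].

Definition monoms_lt omega F : Prop :=
  exists X, [/\ F = 'X_[X], mdeg X = wdeg omega & lexlt (weight X) (wvec omega)].

Definition P_le omega := subspace (monoms_le omega).

Definition Q_weight omega :=
  lquotient (fun F : P_le omega => hit (val F) \/ lspan (monoms_lt omega) (val F)).

Definition pos_classes omega (q : Q_weight omega) : Prop :=
  exists (F : P_le omega) X,
    [/\ val F = 'X_[X], positive_monom X & q = quotient_class _ F].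

Definition Q_weight_pos omega := subspace (@pos_classes omega).

End Steenrod.

(* Main.v *)
(** Everything is computed modulo monomials of weight below omega and inside
the span of the monomials with all exponents positive, which the squares
preserve.

Upper bound: Gaussian elimination among the elements Sq^k(M), k = 1, 2, 4, 8,
each reduced to its terms of weight at least omega, with the largest monomial
as pivot.  Every pivot of weight omega is inadmissible; 925 monomials of weight
omega are left over, and they span.

Lower bound: a linear functional kills all hit elements as soon as it kills
every Sq^k(M), i.e. as soon as it is annihilated by the dual squares on the
homology of (RP^infinity)^5, a divided power algebra.  Such functionals arise
by pushing forward, along linear maps of elementary abelian 2-groups, the
classes a_31 (x) a_7 (x) a_3 and a lift of the degree 8 class detecting c_0.
With one further class, their orbits under the permutations of the variables
have rank 925 on the 925 remaining monomials.  Hence these monomials are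
linearly independent modulo hits and lower weights, which makes them both the
admissible ones and a basis. *)

From Stdlib Require Import PeanoNat.
Require Import Defs.
From mathcomp Require Import all_boot all_order all_algebra mpoly.
From mathcomp Require Import generic_quotient ring_quotient boolp zify.

Set Implicit Arguments. Unset Strict Implicit. Unset Printing Implicit Defensive.

(** * Monomials as exponent lists *)

(** The two computations certify each other. The elimination enters the proof only through the fact
    that each row it produces is hit modulo lower weight, so a relation it overlooked would merely
    leave too many monomials; the rank of the functionals shows that none was overlooked. Neither
    search is verified as an algorithm, only its output is checked.

    The vector omega is the weight of the minimal spike x_1^31 x_2^7 x_3^3, since 31 + 7 + 3 = 41.
    By Singer's criterion monomials of smaller weight in this degree are hit, which explains why
    functionals that kill the hit elements have no terms below omega and so descend to the quotient.

    The obstacle is size: there are C(40,4) = 91390 monomials of degree 41 with five positive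
    exponents. The computations therefore run on plain lists of numbers, with tables and tries, and
    a separate layer of lemmas relates these lists to polynomials. *)

Fixpoint pascal_step (b : bool) (r : seq bool) : seq bool :=
  if r is c :: r' then xorb b c :: pascal_step c r' else [:: b].

Fixpoint pascal (n : nat) : seq bool :=
  if n is n'.+1 then pascal_step false (pascal n') else [:: true].

Definition up_steps_spec a := [seq j <- iota 0 a.+1 | nth false (pascal a) j].
Definition down_steps_spec x :=
  [seq j <- iota 0 x.+1 | nth false (pascal (x - j)) j].
Definition down_mask_spec x :=
  [seq nth false (pascal a) (x - a) | a <- iota 0 x.+1].
(** Six binary digits suffice because 41 < 2^6. *)
Definition bits_spec x := [seq nat_of_bool (odd (x %/ 2 ^ t)) | t <- iota 0 6].

(* Exponents never exceed 41 here; tables spare the kernel the repeated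
   evaluation of Pascal's triangle. *)
Definition up_steps_table := Eval vm_compute in map up_steps_spec (iota 0 42).
Definition down_steps_table := Eval vm_compute in map down_steps_spec (iota 0 42).
Definition down_mask_table := Eval vm_compute in map down_mask_spec (iota 0 42).
Definition bits_table := Eval vm_compute in map bits_spec (iota 0 42).

(** Outside the table the specification itself is evaluated, so the identities hold for every
    exponent and no bound has to be carried along. *)
Definition tabulated T (table : seq T) (f : nat -> T) (x : nat) : T :=
  if onth table x is Some y then y else f x.
Definition up_steps := tabulated up_steps_table up_steps_spec.
Definition down_steps := tabulated down_steps_table down_steps_spec.
Definition down_mask := tabulated down_mask_table down_mask_spec.
Definition bits := tabulated bits_table bits_spec.

Fixpoint lexcmp (s t : seq nat) : comparison :=
  match s, t with
  | x :: s', y :: t' =>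
      match Nat.compare x y with Eq => lexcmp s' t' | c => c end
  | [::], [::] => Eq
  | [::], _ => Lt
  | _, [::] => Gt
  end.

Definition is_lt (c : comparison) := if c is Lt then true else false.
Definition is_eq (c : comparison) := if c is Eq then true else false.
Definition is_gt (c : comparison) := if c is Gt then true else false.

Fixpoint add_lists (s t : seq nat) :=
  match s, t with
  | x :: s', y :: t' => Nat.add x y :: add_lists s' t'
  | _, _ => [::]
  end.

Definition weights (X : seq nat) :=
  foldr (fun x w => add_lists (bits x) w) [:: 0; 0; 0; 0; 0; 0] X.
(* For monomials of the same degree, the lexicographic order on keys is the
   order of the paper. *)
Definition key X := weights X ++ X.
Definition unkey (z : seq nat) := drop 6 z.
Definition tdeg (X : seq nat) := foldr Nat.add 0 X.
Definition omega_weights := [:: 3; 3; 2; 1; 1; 0].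

Definition deg41 (X : seq nat) := Nat.eqb (size X) 5 && Nat.eqb (tdeg X) 41.
(** A key is longer than [omega_weights]: when the weights tie, the comparison does not end in [Lt],
    so weight omega does not count as low. *)
Definition low_weight X := is_lt (lexcmp (key X) omega_weights).
Definition all_pos (X : seq nat) := all (fun x => if x is 0 then false else true) X.
Definition target X :=
  [&& deg41 X, all_pos X & is_eq (lexcmp (weights X) omega_weights)].

(* The exponent lists of Sq^k(x^M), and below those of the M with x^X in Sq^k(x^M). *)
Fixpoint sq_terms k (M : seq nat) : seq (seq nat) :=
  if M is a :: M' then
    flatten [seq if Nat.leb j k
                 then map (cons (Nat.add a j)) (sq_terms (Nat.sub k j) M')
                 else [::] | j <- up_steps a]
  else if k is 0 then [:: [::]] else [::].

Fixpoint sq_sources k (X : seq nat) : seq (seq nat) :=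
  if X is x :: X' then
    flatten [seq if Nat.leb j k
                 then map (cons (Nat.sub x j)) (sq_sources (Nat.sub k j) X')
                 else [::] | j <- down_steps x]
  else if k is 0 then [:: [::]] else [::].

(** * Gaussian elimination among the hit elements *)

(** Addition modulo 2 of rows kept in decreasing order, so that the head is the leading term. Equal
    keys cancel. *)
Fixpoint merge_rows (s : seq (seq nat)) : seq (seq nat) -> seq (seq nat) :=
  if s is x :: s' then
    fix merge_s t :=
      if t is y :: t' then
        match lexcmp x y with
        | Eq => merge_rows s' t'
        | Gt => x :: merge_rows s' t
        | Lt => y :: merge_s t'
        end
      else s
  else id.

(* Terms of weight below omega are dropped: they are smaller than every monomial
   of weight omega, so they never matter for inadmissibility. *)
Definition row_of (L : seq (seq nat)) :=
  foldr (fun Y r => if low_weight Y then r else merge_rows [:: key Y] r) [::] L.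

(** The value k = 0 is excluded because Sq^0 is the identity, which yields no hit element. *)
Definition good_source k M :=
  if k is 0 then false
  else Nat.eqb (size M) 5 && Nat.eqb (Nat.add k (tdeg M)) 41.

(* Looks for one Sq^k(M) whose largest term is z; this succeeds for all but 755
   of the inadmissible monomials. *)
Fixpoint first_row z k (Ms : seq (seq nat)) : option (seq (seq nat)) :=
  if Ms is M :: Ms' then
    let L := sq_terms k M in
    if all (fun Y => ~~ is_gt (lexcmp (key Y) z)) L && good_source k M
    then Some (row_of L) else first_row z k Ms'
  else None.

Fixpoint direct_row z (ks : seq nat) : option (seq (seq nat)) :=
  if ks is k :: ks' then
    if first_row z k (sq_sources k (unkey z)) is Some r then Some r
    else direct_row z ks'
  else None.

Inductive trie (A : Type) := Leaf | Node (v : option A) (l r : trie A).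
Arguments Leaf {A}.

Fixpoint get A (p : seq bool) (t : trie A) : option A :=
  if t is Node v l r then
    if p is b :: p' then if b then get p' l else get p' r else v
  else None.

Fixpoint alter A (f : option A -> option A) (p : seq bool) (t : trie A) : trie A :=
  if p is b :: p' then
    match t with
    | Leaf => if b then Node None (alter f p' Leaf) Leaf
              else Node None Leaf (alter f p' Leaf)
    | Node v l r => if b then Node v (alter f p' l) r
                    else Node v l (alter f p' r)
    end
  else
    match t with
    | Leaf => Node (f None) Leaf Leaf
    | Node v l r => Node (f v) l r
    end.

(* Tries are indexed by exponents written in unary: the total length of a path
   is the degree plus the number of variables. *)
Fixpoint unary (X : seq nat) : seq bool :=
  if X is x :: X' then
    (fix walk x := if x is x'.+1 then true :: walk x' else false :: unary X') x
  else [::].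

Definition find_row (tab : trie (seq (seq nat))) z :=
  if get (unary (unkey z)) tab is Some r then Some r
  else direct_row z [:: 1; 2; 4; 8].

(** Only leading terms are eliminated. Rows found directly are stored on the way, so that they are
    looked up the next time. Running out of fuel leaves a row that is less reduced but still hit
    modulo lower weight. *)
Fixpoint reduce_row fuel tab (r : seq (seq nat)) :
    trie (seq (seq nat)) * seq (seq nat) :=
  match fuel, r with
  | n.+1, z :: _ =>
      if get (unary (unkey z)) tab is Some r' then
        reduce_row n tab (merge_rows r r')
      else if direct_row z [:: 1; 2; 4; 8] is Some r' then
        reduce_row n (alter (fun=> Some r') (unary (unkey z)) tab)
          (merge_rows r r')
      else (tab, r)
  | _, _ => (tab, r)
  end.

(** The source alone determines the square, since k = 41 - deg M. *)
Definition add_seed (tab : trie (seq (seq nat))) (M : seq nat) :=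
  let k := Nat.sub 41 (tdeg M) in
  if good_source k M then
    let: (tab', r) := reduce_row 1000 tab (row_of (sq_terms k M)) in
    if r is z :: _ then alter (fun=> Some r) (unary (unkey z)) tab' else tab'
  else tab.

(** Leading term and tail are rechecked on the row that was found, so no invariant of the
    elimination is needed here. The key is recomputed from [unkey y] because nothing records that
    the entries of a row are keys. *)
Definition certified tab X :=
  if find_row tab (key X) is Some (z :: r) then
    is_eq (lexcmp (unkey z) X) &&
    all (fun y => target (unkey y) && is_lt (lexcmp (key (unkey y)) (key X))) r
  else false.

Fixpoint pos_monoms (m d : nat) : seq (seq nat) :=
  if m is m'.+1 then
    flatten [seq map (cons a) (pos_monoms m' (Nat.sub d a)) | a <- iota 1 d]
  else if d is 0 then [:: [::]] else [::].

Fixpoint chunk5 (s : seq nat) : seq (seq nat) :=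
  if s is [:: a, b, c, d, e & s'] then [:: a; b; c; d; e] :: chunk5 s' else [::].

(* Found by computer: the sources M whose squares, once reduced, supply the pivots
   that are not the largest term of a single Sq^k(M). *)
Definition seeds := chunk5 [::
2; 2; 1; 3; 31; 2; 2; 1; 7; 27; 2; 2; 1; 11; 23; 2; 2; 1; 15; 19; 2; 2; 1;
27; 7; 2; 2; 1; 31; 3; 2; 2; 3; 1; 31; 2; 2; 3; 3; 29; 2; 2; 3; 5; 27; 2; 2;
3; 7; 25; 2; 2; 3; 9; 23; 2; 2; 3; 11; 21; 2; 2; 3; 13; 19; 2; 2; 3; 15; 17;
2; 2; 3; 25; 7; 2; 2; 3; 27; 5; 2; 2; 3; 29; 3; 2; 2; 3; 31; 1; 2; 2; 7; 1;
27; 2; 2; 7; 3; 25; 2; 2; 7; 9; 19; 2; 2; 7; 11; 17; 2; 2; 7; 25; 3; 2; 2;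
7; 27; 1; 2; 2; 9; 3; 23; 2; 2; 9; 7; 19; 2; 2; 9; 23; 3; 2; 2; 11; 1; 23;
2; 2; 11; 3; 21; 2; 2; 11; 5; 19; 2; 2; 11; 7; 17; 2; 2; 11; 17; 7; 2; 2;
11; 19; 5; 2; 2; 11; 21; 3; 2; 2; 11; 23; 1; 2; 2; 15; 1; 19; 2; 2; 15; 3;
17; 2; 2; 15; 17; 3; 2; 2; 15; 19; 1; 2; 2; 27; 1; 7; 2; 2; 27; 3; 5; 2; 2;
27; 5; 3; 2; 2; 27; 7; 1; 2; 2; 31; 1; 3; 2; 2; 31; 3; 1; 2; 3; 2; 1; 31; 2;
3; 2; 3; 29; 2; 3; 2; 5; 27; 2; 3; 2; 7; 25; 2; 3; 2; 9; 23; 2; 3; 2; 11;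
21; 2; 3; 2; 13; 19; 2; 3; 2; 15; 17; 2; 3; 2; 25; 7; 2; 3; 2; 27; 5; 2; 3;
2; 29; 3; 2; 3; 2; 31; 1; 2; 3; 3; 2; 29; 2; 3; 3; 3; 28; 2; 3; 3; 4; 27; 2;
3; 3; 6; 25; 2; 3; 3; 7; 24; 2; 3; 3; 8; 23; 2; 3; 3; 10; 21; 2; 3; 3; 11;
20; 2; 3; 3; 12; 19; 2; 3; 3; 14; 17; 2; 3; 3; 15; 16; 2; 3; 3; 24; 7; 2; 3;
3; 26; 5; 2; 3; 3; 27; 4; 2; 3; 3; 28; 3; 2; 3; 3; 30; 1; 2; 3; 4; 3; 27; 2;
3; 4; 11; 19; 2; 3; 4; 27; 3; 2; 3; 6; 1; 27; 2; 3; 6; 3; 25; 2; 3; 6; 9;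
19; 2; 3; 6; 11; 17; 2; 3; 6; 25; 3; 2; 3; 6; 27; 1; 2; 3; 7; 2; 25; 2; 3;
7; 3; 24; 2; 3; 7; 8; 19; 2; 3; 7; 10; 17; 2; 3; 7; 11; 16; 2; 3; 7; 24; 3;
2; 3; 7; 26; 1; 2; 3; 8; 3; 23; 2; 3; 8; 7; 19; 2; 3; 8; 19; 7; 2; 3; 8; 23;
3; 2; 3; 10; 1; 23; 2; 3; 10; 3; 21; 2; 3; 10; 5; 19; 2; 3; 10; 7; 17; 2; 3;
10; 17; 7; 2; 3; 10; 19; 5; 2; 3; 10; 21; 3; 2; 3; 10; 23; 1; 2; 3; 11; 2;
21; 2; 3; 11; 3; 20; 2; 3; 11; 4; 19; 2; 3; 11; 6; 17; 2; 3; 11; 7; 16; 2;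
3; 11; 16; 7; 2; 3; 11; 18; 5; 2; 3; 11; 19; 4; 2; 3; 11; 20; 3; 2; 3; 11;
22; 1; 2; 3; 12; 3; 19; 2; 3; 12; 19; 3; 2; 3; 14; 1; 19; 2; 3; 14; 3; 17;
2; 3; 14; 17; 3; 2; 3; 14; 19; 1; 2; 3; 15; 2; 17; 2; 3; 15; 3; 16; 2; 3;
15; 16; 3; 2; 3; 15; 18; 1; 2; 3; 24; 3; 7; 2; 3; 24; 7; 3; 2; 3; 26; 1; 7;
2; 3; 26; 3; 5; 2; 3; 26; 5; 3; 2; 3; 26; 7; 1; 2; 3; 27; 2; 5; 2; 3; 27; 3;
4; 2; 3; 27; 4; 3; 2; 3; 27; 6; 1; 2; 3; 28; 3; 3; 2; 3; 30; 1; 3; 2; 3; 30;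
3; 1; 2; 3; 31; 2; 1; 2; 4; 3; 3; 27; 2; 4; 3; 11; 19; 2; 4; 3; 27; 3; 2; 4;
11; 3; 19; 2; 4; 11; 19; 3; 2; 4; 27; 3; 3; 2; 7; 2; 1; 27; 2; 7; 2; 3; 25;
2; 7; 2; 9; 19; 2; 7; 2; 11; 17; 2; 7; 2; 25; 3; 2; 7; 2; 27; 1; 2; 7; 3; 2;
25; 2; 7; 3; 3; 24; 2; 7; 3; 8; 19; 2; 7; 3; 10; 17; 2; 7; 3; 11; 16; 2; 7;
3; 24; 3; 2; 7; 3; 26; 1; 2; 7; 8; 3; 19; 2; 7; 8; 19; 3; 2; 7; 10; 1; 19;
2; 7; 10; 3; 17; 2; 7; 10; 17; 3; 2; 7; 10; 19; 1; 2; 7; 11; 2; 17; 2; 7;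
11; 3; 16; 2; 7; 11; 16; 3; 2; 7; 11; 18; 1; 2; 7; 24; 3; 3; 2; 7; 26; 1; 3;
2; 7; 26; 3; 1; 2; 7; 27; 2; 1; 2; 8; 3; 3; 23; 2; 8; 3; 7; 19; 2; 8; 3; 19;
7; 2; 8; 3; 23; 3; 2; 8; 7; 3; 19; 2; 8; 7; 19; 3; 2; 8; 19; 3; 7; 2; 8; 19;
7; 3; 2; 8; 23; 3; 3; 2; 10; 1; 3; 23; 2; 10; 1; 7; 19; 2; 10; 1; 23; 3; 2;
10; 3; 1; 23; 2; 10; 3; 3; 21; 2; 10; 3; 5; 19; 2; 10; 3; 7; 17; 2; 10; 3;
21; 3; 2; 10; 3; 23; 1; 2; 10; 7; 1; 19; 2; 10; 7; 3; 17; 2; 10; 7; 17; 3;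
2; 10; 7; 19; 1; 2; 10; 23; 1; 3; 2; 10; 23; 3; 1; 2; 11; 2; 1; 23; 2; 11;
2; 3; 21; 2; 11; 2; 5; 19; 2; 11; 2; 7; 17; 2; 11; 2; 17; 7; 2; 11; 2; 19;
5; 2; 11; 2; 21; 3; 2; 11; 2; 23; 1; 2; 11; 3; 2; 21; 2; 11; 3; 3; 20; 2;
11; 3; 4; 19; 2; 11; 3; 6; 17; 2; 11; 3; 7; 16; 2; 11; 3; 16; 7; 2; 11; 3;
18; 5; 2; 11; 3; 19; 4; 2; 11; 3; 20; 3; 2; 11; 3; 22; 1; 2; 11; 4; 3; 19;
2; 11; 4; 19; 3; 2; 11; 6; 1; 19; 2; 11; 6; 3; 17; 2; 11; 6; 17; 3; 2; 11;
6; 19; 1; 2; 11; 7; 2; 17; 2; 11; 7; 3; 16; 2; 11; 7; 16; 3; 2; 11; 7; 18;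
1; 2; 11; 16; 3; 7; 2; 11; 16; 7; 3; 2; 11; 18; 1; 7; 2; 11; 18; 3; 5; 2;
11; 18; 5; 3; 2; 11; 18; 7; 1; 2; 11; 19; 2; 5; 2; 11; 19; 3; 4; 2; 11; 19;
4; 3; 2; 11; 19; 6; 1; 2; 11; 20; 3; 3; 2; 11; 22; 1; 3; 2; 11; 22; 3; 1; 2;
11; 23; 2; 1; 2; 12; 3; 3; 19; 2; 12; 3; 19; 3; 2; 12; 19; 3; 3; 2; 15; 2;
1; 19; 2; 15; 2; 3; 17; 2; 15; 2; 17; 3; 2; 15; 2; 19; 1; 2; 15; 3; 2; 17;
2; 15; 3; 3; 16; 2; 15; 3; 16; 3; 2; 15; 3; 18; 1; 2; 15; 16; 3; 3; 2; 15;
18; 1; 3; 2; 15; 18; 3; 1; 2; 15; 19; 2; 1; 2; 24; 3; 3; 7; 2; 24; 3; 7; 3;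
2; 24; 7; 3; 3; 2; 27; 2; 1; 7; 2; 27; 2; 3; 5; 2; 27; 2; 5; 3; 2; 27; 2; 7;
1; 2; 27; 3; 2; 5; 2; 27; 3; 3; 4; 2; 27; 3; 4; 3; 2; 27; 3; 6; 1; 2; 27; 4;
3; 3; 2; 27; 6; 1; 3; 2; 27; 6; 3; 1; 2; 27; 7; 2; 1; 2; 28; 3; 3; 3; 2; 31;
2; 1; 3; 2; 31; 2; 3; 1; 2; 31; 3; 2; 1; 3; 2; 2; 3; 27; 3; 2; 2; 11; 19; 3;
2; 2; 27; 3; 3; 2; 3; 2; 27; 3; 2; 3; 3; 26; 3; 2; 3; 10; 19; 3; 2; 3; 11;
18; 3; 2; 3; 26; 3; 3; 2; 3; 27; 2; 3; 2; 10; 3; 19; 3; 2; 10; 19; 3; 3; 2;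
11; 2; 19; 3; 2; 11; 3; 18; 3; 2; 11; 18; 3; 3; 2; 11; 19; 2; 3; 2; 26; 3;
3; 3; 2; 27; 2; 3; 3; 2; 27; 3; 2; 3; 3; 2; 2; 27; 3; 3; 2; 3; 26; 3; 3; 2;
10; 19; 3; 3; 2; 11; 18; 3; 3; 2; 26; 3; 3; 3; 2; 27; 2; 3; 3; 3; 2; 26; 3;
3; 3; 10; 18; 3; 3; 3; 26; 2; 3; 3; 10; 2; 19; 3; 3; 10; 3; 18; 3; 3; 10;
18; 3; 3; 3; 10; 19; 2; 3; 3; 11; 2; 18; 3; 3; 11; 18; 2; 3; 3; 26; 2; 3; 3;
3; 26; 3; 2; 3; 3; 27; 2; 2; 3; 10; 2; 3; 19; 3; 10; 2; 19; 3; 3; 10; 3; 2;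
19; 3; 10; 3; 3; 18; 3; 10; 3; 18; 3; 3; 10; 3; 19; 2; 3; 10; 18; 3; 3; 3;
10; 19; 2; 3; 3; 10; 19; 3; 2; 3; 11; 2; 2; 19; 3; 11; 2; 3; 18; 3; 11; 2;
18; 3; 3; 11; 2; 19; 2; 3; 11; 3; 2; 18; 3; 11; 3; 18; 2; 3; 11; 18; 2; 3;
3; 11; 18; 3; 2; 3; 11; 19; 2; 2; 3; 26; 2; 3; 3; 3; 26; 3; 2; 3; 3; 26; 3;
3; 2; 3; 27; 2; 2; 3; 3; 27; 2; 3; 2; 3; 27; 3; 2; 2; 7; 2; 2; 1; 27; 7; 2;
2; 3; 25; 7; 2; 2; 9; 19; 7; 2; 2; 11; 17; 7; 2; 2; 25; 3; 7; 2; 2; 27; 1;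
7; 2; 3; 2; 25; 7; 2; 3; 3; 24; 7; 2; 3; 8; 19; 7; 2; 3; 10; 17; 7; 2; 3;
11; 16; 7; 2; 3; 24; 3; 7; 2; 3; 26; 1; 7; 2; 8; 3; 19; 7; 2; 8; 19; 3; 7;
2; 10; 1; 19; 7; 2; 10; 3; 17; 7; 2; 10; 17; 3; 7; 2; 10; 19; 1; 7; 2; 11;
2; 17; 7; 2; 11; 3; 16; 7; 2; 11; 16; 3; 7; 2; 11; 18; 1; 7; 2; 24; 3; 3; 7;
2; 26; 1; 3; 7; 2; 26; 3; 1; 7; 2; 27; 2; 1; 7; 8; 2; 3; 19; 7; 8; 2; 19; 3;
7; 8; 18; 3; 3; 7; 10; 2; 1; 19; 7; 10; 2; 3; 17; 7; 10; 2; 17; 3; 7; 10; 2;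
19; 1; 7; 10; 3; 2; 17; 7; 10; 3; 3; 16; 7; 10; 3; 16; 3; 7; 10; 3; 18; 1;
7; 10; 16; 3; 3; 7; 10; 18; 1; 3; 7; 10; 18; 3; 1; 7; 10; 19; 2; 1; 7; 24;
2; 3; 3; 7; 26; 2; 1; 3; 7; 26; 2; 3; 1; 7; 26; 3; 2; 1; 8; 2; 3; 3; 23; 8;
2; 3; 7; 19; 8; 2; 3; 23; 3; 8; 2; 7; 3; 19; 8; 2; 7; 19; 3; 8; 2; 23; 3; 3;
8; 7; 2; 3; 19; 8; 7; 2; 19; 3; 8; 7; 18; 3; 3; 8; 23; 2; 3; 3; 10; 2; 1; 3;
23; 10; 2; 1; 7; 19; 10; 2; 1; 23; 3; 10; 2; 3; 1; 23; 10; 2; 3; 3; 21; 10;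
2; 3; 5; 19; 10; 2; 3; 7; 17; 10; 2; 3; 21; 3; 10; 2; 3; 23; 1; 10; 2; 7; 1;
19; 10; 2; 7; 3; 17; 10; 2; 7; 17; 3; 10; 2; 7; 19; 1; 10; 2; 23; 1; 3; 10;
2; 23; 3; 1; 10; 3; 2; 1; 23; 10; 3; 2; 3; 21; 10; 3; 2; 5; 19; 10; 3; 2; 7;
17; 10; 3; 2; 21; 3; 10; 3; 2; 23; 1; 10; 3; 3; 2; 21; 10; 3; 3; 3; 20; 10;
3; 3; 4; 19; 10; 3; 3; 6; 17; 10; 3; 3; 7; 16; 10; 3; 3; 16; 7; 10; 3; 3;
19; 4; 10; 3; 3; 20; 3; 10; 3; 3; 22; 1; 10; 3; 4; 3; 19; 10; 3; 4; 19; 3;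
10; 3; 6; 1; 19; 10; 3; 6; 3; 17; 10; 3; 6; 17; 3; 10; 3; 6; 19; 1; 10; 3;
7; 2; 17; 10; 3; 7; 3; 16; 10; 3; 7; 16; 3; 10; 3; 7; 18; 1; 10; 3; 16; 3;
7; 10; 3; 16; 7; 3; 10; 3; 19; 3; 4; 10; 3; 19; 4; 3; 10; 3; 20; 3; 3; 10;
3; 22; 1; 3; 10; 3; 22; 3; 1; 10; 3; 23; 2; 1; 10; 4; 3; 3; 19; 10; 4; 3;
19; 3; 10; 4; 19; 3; 3; 10; 7; 2; 1; 19; 10; 7; 2; 3; 17; 10; 7; 2; 17; 3;
10; 7; 2; 19; 1; 10; 7; 3; 2; 17; 10; 7; 3; 3; 16; 10; 7; 3; 16; 3; 10; 7;
3; 18; 1; 10; 7; 16; 3; 3; 10; 7; 18; 1; 3; 10; 7; 18; 3; 1; 10; 7; 19; 2;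
1; 10; 19; 3; 3; 4; 10; 19; 3; 4; 3; 10; 20; 3; 3; 3; 10; 23; 2; 1; 3; 10;
23; 2; 3; 1; 10; 23; 3; 2; 1; 15; 2; 2; 1; 19; 15; 2; 2; 3; 17; 15; 2; 2;
17; 3; 15; 2; 2; 19; 1; 15; 2; 3; 2; 17; 15; 2; 3; 3; 16; 15; 2; 3; 16; 3;
15; 2; 3; 18; 1; 15; 2; 16; 3; 3; 15; 2; 18; 1; 3; 15; 2; 18; 3; 1; 15; 2;
19; 2; 1; 15; 16; 2; 3; 3; 15; 18; 2; 1; 3; 15; 18; 2; 3; 1; 15; 18; 3; 2;
1; 26; 3; 3; 3; 4; 26; 3; 3; 4; 3; 26; 3; 4; 3; 3; 31; 2; 2; 1; 3; 31; 2; 2;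
3; 1; 31; 2; 3; 2; 1; 1; 12; 2; 7; 15; 1; 12; 2; 15; 7; 1; 12; 3; 6; 15; 1;
12; 3; 7; 14; 1; 12; 3; 14; 7; 1; 12; 3; 15; 6; 1; 12; 6; 3; 15; 1; 12; 6;
7; 11; 1; 12; 6; 11; 7; 1; 12; 6; 15; 3; 1; 12; 7; 2; 15; 1; 12; 7; 3; 14;
1; 12; 7; 6; 11; 1; 12; 7; 7; 10; 1; 12; 7; 10; 7; 1; 12; 7; 11; 6; 1; 12;
7; 14; 3; 1; 12; 7; 15; 2; 1; 12; 14; 3; 7; 1; 12; 14; 7; 3; 1; 12; 15; 2;
7; 1; 12; 15; 3; 6; 1; 12; 15; 6; 3; 1; 12; 15; 7; 2; 1; 13; 2; 6; 15; 1;
13; 2; 7; 14; 1; 13; 2; 14; 7; 1; 13; 2; 15; 6; 1; 13; 3; 6; 14; 1; 13; 3;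
14; 6; 1; 13; 6; 2; 15; 1; 13; 6; 3; 14; 1; 13; 6; 6; 11; 1; 13; 6; 7; 10;
1; 13; 6; 10; 7; 1; 13; 6; 11; 6; 1; 13; 6; 14; 3; 1; 13; 6; 15; 2; 1; 13;
7; 2; 14; 1; 13; 7; 6; 10; 1; 13; 7; 10; 6; 1; 13; 7; 14; 2; 1; 13; 14; 2;
7; 1; 13; 14; 3; 6; 1; 13; 14; 6; 3; 1; 13; 14; 7; 2; 1; 13; 15; 2; 6; 1;
13; 15; 6; 2; 1; 14; 12; 3; 7; 1; 14; 12; 7; 3; 1; 14; 13; 2; 7; 1; 14; 13;
3; 6; 1; 14; 13; 6; 3; 1; 14; 13; 7; 2; 1; 15; 12; 2; 7; 1; 15; 12; 3; 6; 1;
15; 12; 6; 3; 1; 15; 12; 7; 2; 1; 15; 13; 2; 6; 1; 15; 13; 6; 2; 2; 3; 8;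
11; 15; 2; 3; 8; 15; 11; 2; 3; 11; 8; 15; 2; 3; 11; 11; 12; 2; 3; 11; 12;
11; 2; 3; 11; 15; 8; 2; 3; 12; 11; 11; 2; 3; 15; 8; 11; 2; 3; 15; 11; 8; 2;
4; 11; 11; 11; 2; 7; 8; 11; 11; 2; 7; 11; 8; 11; 2; 7; 11; 11; 8; 2; 8; 3;
11; 15; 2; 8; 3; 15; 11; 2; 8; 7; 11; 11; 2; 8; 11; 3; 15; 2; 8; 11; 7; 11;
2; 8; 11; 11; 7; 2; 8; 11; 15; 3; 2; 8; 15; 3; 11; 2; 8; 15; 11; 3; 2; 11;
3; 8; 15; 2; 11; 3; 11; 12; 2; 11; 3; 12; 11; 2; 11; 3; 15; 8; 2; 11; 4; 11;
11; 2; 11; 7; 8; 11; 2; 11; 7; 11; 8; 2; 11; 8; 3; 15; 2; 11; 8; 7; 11; 2;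
11; 8; 11; 7; 2; 11; 8; 15; 3; 2; 11; 11; 3; 12; 2; 11; 11; 4; 11; 2; 11;
11; 7; 8; 2; 11; 11; 8; 7; 2; 11; 11; 11; 4; 2; 11; 11; 12; 3; 2; 11; 12; 3;
11; 2; 11; 12; 11; 3; 2; 11; 15; 3; 8; 2; 11; 15; 8; 3; 2; 12; 3; 11; 11; 2;
12; 11; 3; 11; 2; 12; 11; 11; 3; 2; 15; 3; 8; 11; 2; 15; 3; 11; 8; 2; 15; 8;
3; 11; 2; 15; 8; 11; 3; 2; 15; 11; 3; 8; 2; 15; 11; 8; 3; 3; 2; 10; 11; 11;
3; 2; 11; 10; 11; 3; 2; 11; 11; 10; 3; 3; 10; 10; 11; 3; 3; 10; 11; 10; 3;
3; 11; 10; 10; 3; 10; 2; 11; 11; 3; 10; 3; 10; 11; 3; 10; 3; 11; 10; 3; 10;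
10; 3; 11; 3; 10; 10; 11; 3; 3; 10; 11; 2; 11; 3; 10; 11; 3; 10; 3; 10; 11;
11; 2; 3; 11; 2; 10; 11; 3; 11; 2; 11; 10; 3; 11; 3; 10; 10; 3; 11; 10; 2;
11; 3; 11; 10; 3; 10; 3; 11; 10; 11; 2; 3; 11; 11; 2; 10; 3; 11; 11; 10; 2;
7; 2; 8; 11; 11; 7; 2; 10; 9; 11; 7; 2; 10; 11; 9; 7; 2; 11; 8; 11; 7; 2;
11; 10; 9; 7; 2; 11; 11; 8; 7; 8; 2; 11; 11; 7; 8; 10; 3; 11; 7; 8; 10; 11;
3; 7; 10; 2; 9; 11; 7; 10; 2; 11; 9; 7; 10; 3; 8; 11; 7; 10; 3; 10; 9; 7;
10; 3; 11; 8; 7; 10; 8; 3; 11; 7; 10; 8; 11; 3; 7; 10; 10; 1; 11; 7; 10; 10;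
3; 9; 7; 10; 10; 9; 3; 7; 10; 11; 2; 9; 7; 10; 11; 3; 8; 7; 10; 11; 8; 3;
12; 1; 2; 7; 15; 12; 1; 2; 15; 7; 12; 1; 3; 6; 15; 12; 1; 3; 7; 14; 12; 1;
3; 14; 7; 12; 1; 3; 15; 6; 12; 1; 7; 2; 15; 12; 1; 7; 7; 10; 12; 1; 7; 15;
2; 12; 1; 15; 2; 7; 12; 1; 15; 3; 6; 12; 1; 15; 7; 2; 12; 3; 1; 6; 15; 12;
3; 1; 7; 14; 12; 3; 1; 14; 7; 12; 3; 1; 15; 6; 10; 3; 3; 8; 15; 12; 3; 3; 5;
14; 12; 3; 3; 7; 12; 12; 3; 3; 12; 7; 12; 3; 3; 13; 6; 10; 3; 3; 15; 8; 10;
3; 4; 11; 11; 10; 3; 7; 8; 11; 10; 3; 7; 11; 8; 10; 3; 8; 3; 15; 10; 3; 8;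
7; 11; 10; 3; 8; 11; 7; 10; 3; 8; 15; 3; 12; 3; 5; 2; 15; 12; 3; 5; 7; 10;
12; 3; 5; 10; 7; 12; 3; 5; 15; 2; 12; 3; 7; 1; 14; 12; 3; 7; 3; 12; 12; 3;
7; 4; 11; 12; 3; 7; 5; 10; 10; 3; 11; 7; 8; 10; 3; 11; 8; 7; 12; 3; 7; 11;
4; 12; 3; 7; 12; 3; 12; 3; 7; 13; 2; 12; 3; 12; 3; 7; 12; 3; 12; 7; 3; 12;
3; 13; 2; 7; 12; 3; 13; 3; 6; 12; 3; 13; 7; 2; 12; 3; 15; 1; 6; 10; 3; 15;
3; 8; 10; 3; 15; 8; 3; 12; 3; 15; 5; 2; 10; 4; 3; 11; 11; 10; 4; 11; 3; 11;
10; 4; 11; 11; 3; 10; 7; 3; 8; 11; 10; 7; 3; 11; 8; 10; 7; 8; 3; 11; 10; 7;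
8; 11; 3; 10; 7; 11; 3; 8; 10; 7; 11; 8; 3; 12; 7; 1; 2; 15; 12; 7; 1; 7;
10; 12; 7; 1; 15; 2; 12; 7; 3; 3; 12; 12; 7; 3; 4; 11; 12; 7; 3; 5; 10; 10;
11; 3; 7; 8; 10; 11; 3; 8; 7; 12; 7; 3; 9; 6; 12; 7; 3; 11; 4; 12; 7; 3; 12;
3; 12; 7; 7; 1; 10; 10; 11; 7; 3; 8; 10; 11; 7; 8; 3; 12; 7; 7; 9; 2; 10;
11; 8; 3; 7; 10; 11; 8; 7; 3; 12; 7; 9; 3; 6; 12; 7; 11; 3; 4; 12; 7; 11; 4;
3; 12; 7; 15; 1; 2; 12; 15; 1; 2; 7; 12; 15; 1; 3; 6; 12; 15; 1; 7; 2; 12;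
15; 3; 1; 6; 10; 15; 3; 3; 8; 10; 15; 3; 8; 3; 12; 15; 3; 5; 2; 12; 15; 7;
1; 2; 13; 1; 2; 6; 15; 13; 1; 2; 7; 14; 13; 1; 2; 14; 7; 13; 1; 2; 15; 6;
13; 1; 3; 6; 14; 13; 1; 3; 14; 6; 13; 1; 6; 2; 15; 13; 1; 6; 7; 10; 13; 1;
6; 10; 7; 13; 1; 6; 15; 2; 13; 1; 7; 2; 14; 13; 1; 7; 6; 10; 13; 1; 7; 14;
2; 13; 1; 14; 2; 7; 13; 1; 14; 3; 6; 13; 1; 14; 7; 2; 13; 1; 15; 2; 6; 13;
1; 15; 6; 2; 13; 2; 1; 6; 15; 13; 2; 1; 7; 14; 13; 2; 1; 14; 7; 13; 2; 1;
15; 6; 13; 2; 3; 4; 15; 13; 2; 3; 5; 14; 13; 2; 3; 7; 12; 13; 2; 3; 12; 7;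
13; 2; 3; 13; 6; 13; 2; 3; 15; 4; 13; 2; 4; 3; 15; 13; 2; 4; 7; 11; 13; 2;
4; 15; 3; 13; 2; 5; 2; 15; 13; 2; 5; 3; 14; 13; 2; 5; 6; 11; 13; 2; 5; 7;
10; 13; 2; 5; 10; 7; 13; 2; 5; 11; 6; 13; 2; 5; 14; 3; 13; 2; 5; 15; 2; 13;
2; 7; 1; 14; 13; 2; 7; 3; 12; 13; 2; 7; 4; 11; 13; 2; 7; 5; 10; 13; 2; 7; 7;
8; 13; 2; 7; 11; 4; 13; 2; 7; 13; 2; 13; 2; 13; 2; 7; 13; 2; 13; 3; 6; 13;
2; 13; 7; 2; 13; 2; 15; 1; 6; 13; 2; 15; 3; 4; 13; 2; 15; 4; 3; 13; 2; 15;
5; 2; 13; 3; 1; 6; 14; 13; 3; 1; 14; 6; 13; 3; 2; 4; 15; 13; 3; 2; 5; 14;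
13; 3; 2; 7; 12; 13; 3; 2; 12; 7; 13; 3; 2; 13; 6; 13; 3; 2; 15; 4; 13; 3;
3; 4; 14; 13; 3; 3; 6; 12; 13; 3; 3; 12; 6; 13; 3; 3; 14; 4; 13; 3; 4; 2;
15; 13; 3; 4; 3; 14; 13; 3; 4; 6; 11; 13; 3; 4; 7; 10; 13; 3; 4; 10; 7; 13;
3; 4; 11; 6; 13; 3; 4; 14; 3; 13; 3; 4; 15; 2; 13; 3; 5; 2; 14; 13; 3; 5; 6;
10; 13; 3; 5; 10; 6; 13; 3; 5; 14; 2; 13; 3; 6; 1; 14; 13; 3; 6; 3; 12; 13;
3; 6; 4; 11; 13; 3; 6; 5; 10; 13; 3; 6; 7; 8; 13; 3; 6; 8; 7; 13; 3; 6; 9;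
6; 13; 3; 6; 11; 4; 13; 3; 6; 12; 3; 13; 3; 6; 13; 2; 13; 3; 7; 2; 12; 13;
3; 7; 4; 10; 13; 3; 7; 6; 8; 13; 3; 7; 8; 6; 13; 3; 7; 10; 4; 13; 3; 7; 12;
2; 13; 3; 12; 2; 7; 13; 3; 12; 3; 6; 13; 3; 12; 7; 2; 13; 3; 13; 2; 6; 13;
3; 13; 6; 2; 13; 3; 14; 1; 6; 13; 3; 14; 3; 4; 13; 3; 14; 4; 3; 13; 3; 14;
5; 2; 13; 3; 15; 2; 4; 13; 3; 15; 4; 2; 13; 6; 1; 2; 15; 13; 6; 1; 7; 10;
13; 6; 1; 15; 2; 13; 6; 3; 5; 10; 13; 6; 3; 9; 6; 13; 6; 7; 1; 10; 13; 6; 7;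
9; 2; 13; 6; 9; 3; 6; 13; 6; 15; 1; 2; 13; 7; 1; 2; 14; 13; 7; 1; 6; 10; 13;
7; 1; 14; 2; 13; 7; 2; 3; 12; 13; 7; 2; 4; 11; 13; 7; 2; 5; 10; 13; 7; 2; 7;
8; 13; 7; 2; 9; 6; 13; 7; 2; 11; 4; 13; 7; 3; 2; 12; 13; 7; 3; 4; 10; 13; 7;
3; 6; 8; 13; 7; 3; 8; 6; 13; 7; 3; 10; 4; 13; 7; 3; 12; 2; 13; 7; 6; 1; 10;
13; 7; 6; 9; 2; 13; 7; 7; 2; 8; 13; 7; 7; 8; 2; 13; 7; 8; 3; 6; 13; 7; 9; 2;
6; 13; 7; 9; 6; 2; 13; 7; 10; 1; 6; 13; 7; 10; 5; 2; 13; 7; 11; 2; 4; 13; 7;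
14; 1; 2; 13; 14; 1; 2; 7; 13; 14; 1; 3; 6; 13; 14; 1; 7; 2; 13; 14; 3; 1;
6; 13; 14; 3; 5; 2; 13; 14; 7; 1; 2; 13; 15; 1; 2; 6; 13; 15; 1; 6; 2; 13;
15; 2; 1; 6; 13; 15; 2; 3; 4; 13; 15; 2; 4; 3; 13; 15; 2; 5; 2; 13; 15; 3;
2; 4; 13; 15; 3; 4; 2; 13; 15; 6; 1; 2; 15; 1; 12; 2; 7; 15; 1; 12; 3; 6;
15; 1; 12; 6; 3; 15; 1; 12; 7; 2; 15; 1; 13; 2; 6; 15; 1; 13; 6; 2; 15; 2;
3; 8; 11; 15; 2; 3; 11; 8; 15; 2; 8; 3; 11; 15; 2; 8; 11; 3; 15; 2; 11; 3;
8; 15; 2; 11; 8; 3; 15; 12; 1; 2; 7; 15; 12; 1; 3; 6; 15; 12; 1; 7; 2; 15;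
12; 3; 1; 6; 15; 10; 3; 3; 8; 15; 10; 3; 8; 3; 15; 12; 3; 5; 2; 15; 12; 7;
1; 2; 15; 13; 1; 2; 6; 15; 13; 1; 6; 2; 15; 13; 2; 1; 6; 15; 13; 2; 3; 4;
15; 13; 2; 4; 3; 15; 13; 2; 5; 2; 15; 13; 3; 2; 4; 15; 13; 3; 4; 2; 15; 13;
6; 1; 2; 2; 3; 4; 15; 15; 2; 3; 7; 12; 15; 2; 3; 7; 15; 12; 2; 3; 12; 7; 15;
2; 3; 12; 15; 7; 2; 3; 15; 4; 15; 2; 3; 15; 7; 12; 2; 3; 15; 12; 7; 2; 3;
15; 15; 4; 2; 4; 3; 15; 15; 2; 4; 7; 11; 15; 2; 4; 7; 15; 11; 2; 4; 11; 7;
15; 2; 4; 11; 15; 7; 2; 4; 15; 3; 15; 2; 4; 15; 7; 11; 2; 4; 15; 11; 7; 2;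
4; 15; 15; 3; 2; 7; 3; 12; 15; 2; 7; 3; 15; 12; 2; 7; 4; 11; 15; 2; 7; 4;
15; 11; 2; 7; 7; 8; 15; 2; 7; 7; 11; 12; 2; 7; 7; 12; 11; 2; 7; 7; 15; 8; 2;
7; 8; 7; 15; 2; 7; 8; 15; 7; 2; 7; 11; 4; 15; 2; 7; 11; 7; 12; 2; 7; 11; 12;
7; 2; 7; 11; 15; 4; 2; 7; 12; 3; 15; 2; 7; 12; 7; 11; 2; 7; 12; 11; 7; 2; 7;
12; 15; 3; 2; 7; 15; 3; 12; 2; 7; 15; 4; 11; 2; 7; 15; 7; 8; 2; 7; 15; 8; 7;
2; 7; 15; 11; 4; 2; 7; 15; 12; 3; 2; 8; 7; 7; 15; 2; 8; 7; 15; 7; 2; 8; 15;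
7; 7; 2; 11; 4; 7; 15; 2; 11; 4; 15; 7; 2; 11; 7; 4; 15; 2; 11; 7; 7; 12; 2;
11; 7; 12; 7; 2; 11; 7; 15; 4; 2; 11; 15; 4; 7; 2; 11; 15; 7; 4; 2; 12; 3;
7; 15; 2; 12; 3; 15; 7; 2; 12; 7; 3; 15; 2; 12; 7; 7; 11; 2; 12; 7; 11; 7;
2; 12; 7; 15; 3; 2; 12; 15; 3; 7; 2; 12; 15; 7; 3; 2; 15; 3; 4; 15; 2; 15;
3; 7; 12; 2; 15; 3; 12; 7; 2; 15; 3; 15; 4; 2; 15; 4; 3; 15; 2; 15; 4; 7;
11; 2; 15; 4; 11; 7; 2; 15; 4; 15; 3; 2; 15; 7; 3; 12; 2; 15; 7; 4; 11; 2;
15; 7; 7; 8; 2; 15; 7; 8; 7; 2; 15; 7; 11; 4; 2; 15; 7; 12; 3; 2; 15; 8; 7;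
7; 2; 15; 11; 4; 7; 2; 15; 11; 7; 4; 2; 15; 12; 3; 7; 2; 15; 12; 7; 3; 2;
15; 15; 3; 4; 2; 15; 15; 4; 3; 6; 1; 2; 15; 15; 6; 1; 7; 10; 15; 6; 1; 7;
15; 10; 6; 1; 15; 2; 15; 6; 1; 15; 7; 10; 6; 1; 15; 15; 2; 6; 7; 1; 10; 15;
6; 7; 1; 15; 10; 6; 7; 7; 9; 10; 6; 7; 9; 2; 15; 6; 7; 9; 7; 10; 6; 7; 9;
10; 7; 6; 7; 9; 15; 2; 6; 7; 15; 1; 10; 6; 7; 15; 9; 2; 6; 15; 1; 2; 15; 6;
15; 1; 7; 10; 6; 15; 1; 15; 2; 6; 15; 7; 1; 10; 6; 15; 7; 9; 2; 6; 15; 15;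
1; 2; 7; 2; 3; 12; 15; 7; 2; 3; 15; 12; 7; 2; 4; 11; 15; 7; 2; 4; 15; 11; 7;
2; 7; 8; 15; 7; 2; 7; 11; 12; 7; 2; 7; 12; 11; 7; 2; 7; 15; 8; 7; 2; 8; 7;
15; 7; 2; 8; 15; 7; 7; 2; 11; 4; 15; 7; 2; 11; 7; 12; 7; 2; 11; 12; 7; 7; 2;
11; 15; 4; 7; 2; 12; 3; 15; 7; 2; 12; 7; 11; 7; 2; 12; 11; 7; 7; 2; 12; 15;
3; 7; 2; 15; 3; 12; 7; 2; 15; 4; 11; 7; 2; 15; 7; 8; 7; 2; 15; 8; 7; 7; 2;
15; 11; 4; 7; 2; 15; 12; 3; 7; 6; 1; 10; 15; 7; 6; 1; 15; 10; 7; 6; 7; 9;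
10; 7; 6; 9; 2; 15; 7; 6; 9; 7; 10; 7; 6; 9; 10; 7; 7; 6; 9; 15; 2; 7; 6;
15; 1; 10; 7; 6; 15; 9; 2; 7; 7; 2; 8; 15; 7; 7; 2; 11; 12; 7; 7; 2; 12; 11;
7; 7; 2; 15; 8; 7; 7; 6; 9; 10; 7; 7; 7; 8; 10; 7; 7; 7; 10; 8; 7; 7; 8; 2;
15; 7; 7; 8; 7; 10; 7; 7; 8; 10; 7; 7; 7; 8; 15; 2; 7; 7; 10; 3; 12; 7; 7;
10; 4; 11; 7; 7; 10; 7; 8; 7; 7; 10; 8; 7; 7; 7; 10; 11; 4; 7; 7; 10; 12; 3;
7; 7; 14; 1; 10; 7; 7; 14; 9; 2; 7; 7; 15; 2; 8; 7; 7; 15; 8; 2; 7; 8; 2; 7;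
15; 7; 8; 2; 15; 7; 7; 8; 7; 2; 15; 7; 8; 7; 7; 10; 7; 8; 7; 10; 7; 7; 8; 7;
15; 2; 7; 8; 15; 2; 7; 7; 8; 15; 7; 2; 7; 10; 3; 4; 15; 7; 10; 3; 7; 12; 7;
10; 3; 12; 7; 7; 10; 3; 15; 4; 7; 10; 4; 3; 15; 7; 10; 4; 7; 11; 7; 10; 4;
11; 7; 7; 10; 4; 15; 3; 7; 10; 7; 3; 12; 7; 10; 7; 4; 11; 7; 10; 7; 7; 8; 7;
10; 7; 8; 7; 7; 10; 7; 11; 4; 7; 10; 7; 12; 3; 7; 10; 8; 7; 7; 7; 10; 11; 4;
7; 7; 10; 11; 7; 4; 7; 10; 12; 3; 7; 7; 10; 12; 7; 3; 7; 10; 15; 3; 4; 7;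
10; 15; 4; 3; 7; 14; 1; 2; 15; 7; 14; 1; 7; 10; 7; 14; 1; 15; 2; 7; 14; 7;
1; 10; 7; 14; 7; 9; 2; 7; 14; 15; 1; 2; 7; 15; 2; 3; 12; 7; 15; 2; 4; 11; 7;
15; 2; 7; 8; 7; 15; 2; 8; 7; 7; 15; 2; 11; 4; 7; 15; 2; 12; 3; 7; 15; 6; 1;
10; 7; 15; 6; 9; 2; 7; 15; 7; 2; 8; 7; 15; 7; 8; 2; 7; 15; 8; 2; 7; 7; 15;
8; 7; 2; 7; 15; 10; 3; 4; 7; 15; 10; 4; 3; 7; 15; 14; 1; 2; 15; 2; 3; 4; 15;
15; 2; 3; 7; 12; 15; 2; 3; 12; 7; 15; 2; 3; 15; 4; 15; 2; 4; 3; 15; 15; 2;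
4; 7; 11; 15; 2; 4; 11; 7; 15; 2; 4; 15; 3; 15; 2; 7; 3; 12; 15; 2; 7; 4;
11; 15; 2; 7; 7; 8; 15; 2; 7; 8; 7; 15; 2; 7; 11; 4; 15; 2; 7; 12; 3; 15; 2;
8; 7; 7; 15; 2; 11; 4; 7; 15; 2; 11; 7; 4; 15; 2; 12; 3; 7; 15; 2; 12; 7; 3;
15; 2; 15; 3; 4; 15; 2; 15; 4; 3; 15; 6; 1; 2; 15; 15; 6; 1; 7; 10; 15; 6;
1; 15; 2; 15; 6; 7; 1; 10; 15; 6; 7; 9; 2; 15; 6; 15; 1; 2; 15; 7; 2; 3; 12;
15; 7; 2; 4; 11; 15; 7; 2; 7; 8; 15; 7; 2; 8; 7; 15; 7; 2; 11; 4; 15; 7; 2;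
12; 3; 15; 7; 6; 1; 10; 15; 7; 6; 9; 2; 15; 7; 7; 2; 8; 15; 7; 7; 8; 2; 15;
7; 8; 2; 7; 15; 7; 8; 7; 2; 15; 7; 10; 3; 4; 15; 7; 10; 4; 3; 15; 7; 14; 1;
2; 15; 15; 2; 3; 4; 15; 15; 2; 4; 3; 15; 15; 6; 1; 2].

Definition seed_table := foldl add_seed Leaf seeds.
Definition targets := [seq X <- pos_monoms 5 41 | target X].
Definition uncertified tab := [seq X <- targets | ~~ certified tab X].
(* Evaluated once here; [adm_uncertified] checks the value. *)
Definition adm := Eval vm_compute in uncertified seed_table.

Fixpoint same_lists (s t : seq (seq nat)) :=
  match s, t with
  | [::], [::] => true
  | X :: s', Y :: t' => if is_eq (lexcmp X Y) then same_lists s' t' else false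
  | _, _ => false
  end.

(** * Functionals killed by the dual squares *)

Definition toggle (o : option unit) := if o is None then Some tt else None.
Definition value A (t : trie A) := if t is Node v _ _ then v else None.
Definition lson A (t : trie A) := if t is Node _ l _ then l else Leaf.
Definition rson A (t : trie A) := if t is Node _ _ r then r else Leaf.

Fixpoint toggle_box (ms : seq (seq bool)) : trie unit -> trie unit :=
  if ms is m :: ms' then
    (fix walk m t :=
       if m is b :: m' then
         Node (value t) (walk m' (lson t))
              (if b then toggle_box ms' (rson t) else rson t)
       else t) m
  else fun t => Node (toggle (value t)) (lson t) (rson t).

Definition toggle_set (L : seq (seq nat)) :=
  foldr (fun X => alter toggle (unary X)) Leaf L.
(* The support of Sq_*(S) + S, for the total dual square Sq_*; [toggle_box] adds
   a product of subsets of the five coordinates modulo 2. *)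
Definition dual_squares (S : seq (seq nat)) :=
  foldr (fun X t => toggle_box (map down_mask X) (alter toggle (unary X) t)) Leaf S.
Fixpoint is_empty A (t : trie A) :=
  if t is Node v l r then
    if v is None then if is_empty l then is_empty r else false else false
  else true.
Definition killed S := is_empty (dual_squares S).

(** Reads a trie back into a list: [cur] counts the unary digits of the current exponent, [prefix]
    holds the finished exponents in reverse. *)
Fixpoint elements (t : trie unit) (cur : nat) (prefix : seq nat) : seq (seq nat) :=
  if t is Node v l r then
    (if v is Some _ then [:: rev prefix] else [::]) ++
    elements l cur.+1 prefix ++ elements r 0 (cur :: prefix)
  else [::].

(** The iterated coproduct of a_n: its image under the map RP^infinity -> (RP^infinity)^5 that is
    the identity on the coordinates in J and constant on the others. *)
Fixpoint compositions n (J : seq bool) : seq (seq nat) :=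
  match J with
  | [::] => if n is 0 then [:: [::]] else [::]
  | false :: J' => map (cons 0) (compositions n J')
  | true :: J' =>
      flatten [seq map (cons a) (compositions (Nat.sub n a) J') | a <- iota 0 n.+1]
  end.

(** In a divided power algebra a_x a_y = C(x+y, x) a_(x+y), and by Kummer's theorem this coefficient
    is odd exactly when x and y share no binary digit. *)
Fixpoint disjoint_bits (s t : seq nat) :=
  match s, t with
  | 1 :: _, 1 :: _ => false
  | _ :: s', _ :: t' => disjoint_bits s' t'
  | _, _ => true
  end.

Fixpoint divided_mul (X Y : seq nat) : option (seq nat) :=
  match X, Y with
  | x :: X', y :: Y' =>
      if disjoint_bits (bits x) (bits y)
      then omap (cons (Nat.add x y)) (divided_mul X' Y') else None
  | _, _ => Some [::]
  end.

Definition cancel_mod2 (L : seq (seq nat)) := elements (toggle_set L) 0 [::].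
Definition divided_prod (A B : seq (seq nat)) :=
  cancel_mod2 (flatten [seq pmap (divided_mul a) B | a <- A]).

Fixpoint binary_digits k n : seq bool :=
  if k is k'.+1 then odd n :: binary_digits k' n./2 else [::].

(* The image of a_a (x) a_b (x) a_c under the linear map (Z/2)^3 -> (Z/2)^5 whose
   columns have the binary digits of i, j, k; a_x a_y is a_(x+y) or 0 according to
   whether x and y have disjoint binary digits. *)
Definition spread (a b c i j k : nat) :=
  divided_prod (compositions a (binary_digits 5 i))
    (divided_prod (compositions b (binary_digits 5 j)) (compositions c (binary_digits 5 k))).

(** For k > 0 the binary digits of 2^s - 1 - k are complementary to those of k, so C(2^s - 1 - k, k)
    is even and the dual squares kill a_31, a_7 and a_3. They are natural, so pushforwards stay
    killed. The filter preserves this, since monomials with and without a zero exponent span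
    complementary submodules. *)
Definition spike i j k := filter all_pos (spread 31 7 3 i j k).
(* In degree 8, a_1 a_1 a_6 + a_1 a_2 a_5 + a_1 a_4 a_3 + a_2 a_3 a_3 detects c_0;
   the dual Kameko map a_x |-> a_(2x+1), applied twice, gives this class. *)
Definition lifted_c0 i j k :=
  filter all_pos (cancel_mod2 (spread 7 7 27 i j k ++ spread 7 11 23 i j k ++
                           spread 7 19 15 i j k ++ spread 11 15 15 i j k)).

(* Found by computer. *)
Definition sporadic := chunk5 [::
3; 3; 29; 2; 4; 3; 3; 30; 1; 4; 3; 3; 30; 2; 3; 3; 5; 29; 1; 3; 3; 5; 29; 2;
2; 3; 5; 30; 2; 1; 3; 6; 29; 1; 2; 3; 6; 30; 1; 1; 5; 3; 27; 2; 4; 5; 3; 30;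
1; 2; 5; 3; 30; 2; 1; 5; 5; 27; 1; 3; 5; 5; 27; 2; 2; 5; 6; 27; 1; 2; 6; 3;
27; 1; 4; 6; 3; 27; 2; 3; 6; 3; 29; 1; 2; 6; 3; 29; 2; 1; 6; 5; 27; 2; 1; 6;
6; 27; 1; 1; 7; 5; 23; 2; 4; 7; 6; 23; 1; 4; 7; 6; 23; 2; 3; 7; 7; 19; 1; 7;
7; 7; 19; 3; 5; 7; 7; 21; 2; 4; 7; 7; 21; 3; 3; 7; 7; 22; 1; 4; 7; 7; 22; 2;
3; 7; 7; 23; 1; 3; 7; 9; 19; 2; 4; 7; 9; 21; 1; 3; 7; 9; 21; 2; 2; 7; 9; 22;
1; 2; 7; 10; 19; 1; 4; 7; 10; 19; 2; 3; 7; 10; 21; 2; 1; 7; 10; 22; 1; 1; 7;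
11; 13; 2; 8; 7; 11; 13; 4; 6; 7; 11; 14; 1; 8; 7; 11; 14; 2; 7; 7; 11; 14;
3; 6; 7; 11; 14; 4; 5; 7; 11; 19; 2; 2; 7; 12; 19; 1; 2; 7; 12; 19; 2; 1; 7;
13; 11; 2; 8; 7; 13; 11; 4; 6; 7; 13; 13; 1; 7; 7; 13; 13; 3; 5; 7; 13; 14;
1; 6; 7; 13; 14; 2; 5; 7; 13; 14; 4; 3; 7; 13; 19; 1; 1; 7; 14; 11; 1; 8; 7;
14; 11; 2; 7; 7; 14; 11; 3; 6; 7; 14; 11; 4; 5; 7; 14; 13; 1; 6; 7; 14; 13;
2; 5; 7; 14; 13; 4; 3; 7; 14; 14; 3; 3; 7; 15; 13; 2; 4; 7; 15; 14; 1; 4; 7;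
15; 14; 2; 3; 7; 17; 11; 2; 4; 7; 17; 13; 1; 3; 7; 17; 13; 2; 2; 7; 17; 14;
1; 2; 7; 18; 11; 1; 4; 7; 18; 11; 2; 3; 7; 18; 13; 2; 1; 7; 18; 14; 1; 1; 7;
19; 7; 1; 7; 7; 19; 7; 3; 5; 7; 19; 11; 2; 2; 7; 20; 11; 1; 2; 7; 20; 11; 2;
1; 7; 21; 7; 3; 3; 7; 21; 11; 1; 1; 7; 23; 7; 1; 3; 9; 3; 23; 2; 4; 9; 5;
23; 1; 3; 9; 5; 23; 2; 2; 9; 6; 23; 1; 2; 10; 3; 23; 1; 4; 10; 3; 23; 2; 3;
10; 5; 23; 2; 1; 10; 6; 23; 1; 1; 11; 3; 23; 1; 3; 11; 3; 23; 2; 2; 11; 5;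
19; 2; 4; 11; 5; 21; 1; 3; 11; 5; 21; 2; 2; 11; 5; 22; 1; 2; 11; 6; 19; 1;
4; 11; 6; 19; 2; 3; 11; 6; 21; 2; 1; 11; 6; 22; 1; 1; 11; 7; 13; 2; 8; 11;
7; 13; 4; 6; 11; 7; 14; 1; 8; 11; 7; 14; 2; 7; 11; 7; 14; 3; 6; 11; 7; 14;
4; 5; 11; 7; 15; 1; 7; 11; 7; 15; 3; 5; 11; 7; 19; 1; 3; 11; 9; 15; 2; 4;
11; 10; 15; 1; 4; 11; 10; 15; 2; 3; 11; 11; 11; 1; 7; 11; 11; 11; 3; 5; 11;
11; 13; 2; 4; 11; 11; 13; 3; 3; 11; 11; 14; 1; 4; 11; 11; 14; 2; 3; 11; 11;
15; 2; 2; 11; 12; 15; 1; 2; 11; 12; 15; 2; 1; 11; 13; 7; 2; 8; 11; 13; 7; 4;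
6; 11; 13; 11; 3; 3; 11; 13; 13; 1; 3; 11; 13; 13; 2; 2; 11; 13; 14; 1; 2;
11; 13; 15; 1; 1; 11; 14; 7; 1; 8; 11; 14; 7; 2; 7; 11; 14; 7; 3; 6; 11; 14;
7; 4; 5; 11; 14; 13; 2; 1; 11; 14; 14; 1; 1; 11; 15; 7; 1; 7; 11; 15; 7; 3;
5; 11; 15; 11; 1; 3; 11; 17; 7; 2; 4; 11; 18; 7; 1; 4; 11; 18; 7; 2; 3; 11;
19; 7; 2; 2; 11; 20; 7; 1; 2; 11; 20; 7; 2; 1; 11; 21; 7; 1; 1; 12; 3; 23;
1; 2; 12; 3; 23; 2; 1; 13; 3; 19; 2; 4; 13; 3; 21; 1; 3; 13; 3; 21; 2; 2;
13; 3; 22; 1; 2; 13; 3; 23; 1; 1; 13; 6; 19; 1; 2; 13; 6; 19; 2; 1; 13; 7;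
11; 2; 8; 13; 7; 11; 4; 6; 13; 7; 13; 1; 7; 13; 7; 13; 3; 5; 13; 7; 14; 1;
6; 13; 7; 14; 2; 5; 13; 7; 14; 4; 3; 13; 7; 15; 2; 4; 13; 7; 15; 3; 3; 13;
9; 15; 1; 3; 13; 9; 15; 2; 2; 13; 10; 15; 2; 1; 13; 11; 7; 2; 8; 13; 11; 7;
4; 6; 13; 11; 11; 2; 4; 13; 11; 11; 3; 3; 13; 13; 7; 1; 7; 13; 13; 7; 3; 5;
13; 13; 11; 1; 3; 13; 13; 11; 2; 2; 13; 14; 7; 1; 6; 13; 14; 7; 2; 5; 13;
14; 7; 4; 3; 13; 14; 11; 2; 1; 13; 15; 7; 2; 4; 13; 15; 7; 3; 3; 13; 17; 7;
1; 3; 13; 17; 7; 2; 2; 13; 18; 7; 2; 1; 14; 3; 19; 1; 4; 14; 3; 19; 2; 3;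
14; 3; 21; 2; 1; 14; 3; 22; 1; 1; 14; 5; 19; 1; 2; 14; 5; 19; 2; 1; 14; 7;
11; 1; 8; 14; 7; 11; 2; 7; 14; 7; 11; 3; 6; 14; 7; 11; 4; 5; 14; 7; 13; 1;
6; 14; 7; 13; 2; 5; 14; 7; 13; 4; 3; 14; 7; 14; 3; 3; 14; 7; 15; 1; 4; 14;
7; 15; 2; 3; 14; 9; 15; 1; 2; 14; 10; 15; 1; 1; 14; 11; 7; 1; 8; 14; 11; 7;
2; 7; 14; 11; 7; 3; 6; 14; 11; 7; 4; 5; 14; 11; 11; 1; 4; 14; 11; 11; 2; 3;
14; 13; 7; 1; 6; 14; 13; 7; 2; 5; 14; 13; 7; 4; 3; 14; 13; 11; 1; 2; 14; 14;
7; 3; 3; 14; 14; 11; 1; 1; 14; 15; 7; 1; 4; 14; 15; 7; 2; 3; 14; 17; 7; 1;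
2; 14; 18; 7; 1; 1; 15; 5; 15; 2; 4; 15; 6; 15; 1; 4; 15; 6; 15; 2; 3; 15;
7; 13; 2; 4; 15; 7; 14; 1; 4; 15; 7; 14; 2; 3; 15; 9; 11; 2; 4; 15; 9; 13;
1; 3; 15; 9; 13; 2; 2; 15; 9; 14; 1; 2; 15; 10; 11; 1; 4; 15; 10; 11; 2; 3;
15; 10; 13; 2; 1; 15; 10; 14; 1; 1; 15; 11; 7; 1; 7; 15; 11; 7; 3; 5; 15;
11; 11; 2; 2; 15; 12; 11; 1; 2; 15; 12; 11; 2; 1; 15; 13; 7; 3; 3; 15; 13;
11; 1; 1; 17; 3; 15; 2; 4; 17; 5; 15; 1; 3; 17; 5; 15; 2; 2; 17; 6; 15; 1;
2; 18; 3; 15; 1; 4; 18; 3; 15; 2; 3; 18; 5; 15; 2; 1; 18; 6; 15; 1; 1; 19;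
3; 15; 1; 3; 19; 3; 15; 2; 2; 19; 5; 11; 2; 4; 19; 5; 13; 1; 3; 19; 5; 13;
2; 2; 19; 5; 14; 1; 2; 19; 6; 11; 1; 4; 19; 6; 11; 2; 3; 19; 6; 13; 2; 1;
19; 6; 14; 1; 1; 19; 7; 7; 1; 7; 19; 7; 7; 3; 5; 19; 7; 11; 1; 3; 19; 9; 7;
2; 4; 19; 10; 7; 1; 4; 19; 10; 7; 2; 3; 19; 11; 7; 2; 2; 19; 12; 7; 1; 2;
19; 12; 7; 2; 1; 19; 13; 7; 1; 1; 20; 3; 15; 1; 2; 20; 3; 15; 2; 1; 21; 3;
11; 2; 4; 21; 3; 13; 1; 3; 21; 3; 13; 2; 2; 21; 3; 14; 1; 2; 21; 3; 15; 1;
1; 21; 6; 11; 1; 2; 21; 6; 11; 2; 1; 21; 7; 7; 2; 4; 21; 7; 7; 3; 3; 21; 9;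
7; 1; 3; 21; 9; 7; 2; 2; 21; 10; 7; 2; 1; 22; 3; 11; 1; 4; 22; 3; 11; 2; 3;
22; 3; 13; 2; 1; 22; 3; 14; 1; 1; 22; 5; 11; 1; 2; 22; 5; 11; 2; 1; 22; 7;
7; 1; 4; 22; 7; 7; 2; 3; 22; 9; 7; 1; 2; 22; 10; 7; 1; 1; 23; 5; 7; 2; 4;
23; 6; 7; 1; 4; 23; 6; 7; 2; 3; 23; 7; 7; 1; 3; 25; 3; 7; 2; 4; 25; 5; 7; 1;
3; 25; 5; 7; 2; 2; 25; 6; 7; 1; 2; 26; 3; 7; 1; 4; 26; 3; 7; 2; 3; 26; 5; 7;
2; 1; 26; 6; 7; 1; 1; 27; 3; 7; 1; 3; 27; 3; 7; 2; 2; 28; 3; 7; 1; 2; 28; 3;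
7; 2; 1; 29; 3; 7; 1; 1].

Definition dual_classes := [::
   spike 1 6 24; spike 1 14 16; spike 1 14 18; spike 3 4 24;
   lifted_c0 7 8 16; spike 7 1 24; spike 3 12 16; spike 3 5 24;
   lifted_c0 1 14 16; sporadic; lifted_c0 3 12 16; spike 3 12 17;
   spike 3 12 20; spike 7 8 16; lifted_c0 3 4 24; lifted_c0 7 9 16;
   lifted_c0 1 2 28; spike 15 1 16; lifted_c0 1 6 24; spike 7 8 17;
   spike 15 3 16; lifted_c0 3 13 16; lifted_c0 7 11 16; lifted_c0 7 8 17;
   spike 7 9 16; lifted_c0 3 12 20; lifted_c0 1 14 18; lifted_c0 3 5 24;
   spike 7 9 17; lifted_c0 3 4 25; lifted_c0 3 12 17; spike 7 9 18;
   lifted_c0 3 13 17; lifted_c0 7 9 18].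

Definition permute (s X : seq nat) := [seq nth 0 X i | i <- s].
(** A permuted functional at Z is the original one at a permuted Z, so a single trie serves the
    whole orbit of a class. *)
Definition values (t : trie unit) s (Zs : seq (seq nat)) :=
  [seq if get (unary (permute s Z)) t is Some _ then true else false | Z <- Zs].

Fixpoint xor_lists (r q : seq bool) :=
  match r, q with
  | b :: r', c :: q' => xorb b c :: xor_lists r' q'
  | _, _ => [::]
  end.

(* The i-th entry of the basis is the part after position i of a row whose first
   nonzero entry is at position i. *)
Fixpoint insert_row (r : seq bool) (basis : seq (option (seq bool))) :=
  match r, basis with
  | b :: r', o :: basis' =>
      if b then
        if o is Some q then o :: insert_row (xor_lists r' q) basis'
        else Some r' :: basis'
      else o :: insert_row r' basis'
  | _, _ => basis
  end.

Definition rank_table (sel : seq (nat * seq (seq nat))) :=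
  foldl (fun basis gs =>
      let t := toggle_set (nth [::] dual_classes gs.1) in
      foldl (fun basis s => insert_row (values t s adm) basis) basis gs.2)
    (nseq (size adm) None) sel.

Definition num_pivots (basis : seq (option (seq bool))) := count isSome basis.
(** Greedy choice: a permuted class is kept only if it raises the rank, so that the check in the
    proof inserts no redundant rows. *)
Definition select :=
  let S5 := permutations (iota 0 5) in
  (foldl (fun state g =>
      let t := toggle_set (nth [::] dual_classes g) in
      let st := foldl (fun st s =>
          let basis' := insert_row (values t s adm) st.1 in
          if num_pivots basis' == num_pivots st.1 then st
          else (basis', s :: st.2)) (state.1, [::]) S5 in
      (st.1, rcons state.2 (g, rev st.2)))
    (nseq (size adm) None, [::]) (iota 0 (size dual_classes))).2.
Definition selection := Eval vm_compute in select.

Import GRing.Theory.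
Local Open Scope ring_scope.

(** * Squares of monomials *)

Lemma nth_pascal_step b r k :
  nth false (pascal_step b r) k = nth false (b :: r) k (+) nth false r k.
Proof.
elim: r b k => [|c r IHr] b [|k] /=; rewrite ?addbF ?nth_nil //.
by case: b c => [] [].
Qed.

Lemma nth_pascal n k : nth false (pascal n) k = odd 'C(n, k).
Proof.
elim: n k => [|n IHn] [|k] //=; rewrite ?nth_nil ?bin0n //.
  by rewrite nth_pascal_step /= IHn !bin0.
by rewrite nth_pascal_step /= !IHn binS oddD addbC.
Qed.

Lemma tabulatedE T (table : seq T) f x :
  table = map f (iota 0 42) -> tabulated table f x = f x.
Proof.
move=> ->; rewrite /tabulated onth_map.
by case E: (onth (iota 0 42) x) => [y|] //=; move/(onth_nth 0%N): (E) => <-;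
   rewrite nth_iota //; move: (onthTE (iota 0 42) x); rewrite E size_iota.
Qed.

Lemma up_stepsE a : up_steps a = [seq j <- iota 0 a.+1 | odd 'C(a, j)].
Proof.
rewrite /up_steps tabulatedE; last by vm_compute.
by apply: eq_filter => j; rewrite nth_pascal.
Qed.

Lemma nth_down_mask x a :
  nth false (down_mask x) a = (a <= x)%N && odd 'C(a, x - a).
Proof.
rewrite /down_mask tabulatedE; last by vm_compute.
case: (leqP a x) => ax; last by rewrite nth_default ?size_map ?size_iota.
by rewrite (nth_map 0%N) ?size_iota // nth_iota // nth_pascal.
Qed.

Lemma nth_bits x t : (t < 6)%N -> nth 0%N (bits x) t = odd (x %/ 2 ^ t).
Proof.
move=> t6; rewrite /bits tabulatedE; last by vm_compute.
by rewrite (nth_map 0%N) ?size_iota // nth_iota.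
Qed.

Lemma size_bits x : size (bits x) = 6%N.
Proof. by rewrite /bits tabulatedE ?size_map //; vm_compute. Qed.

Section SqMonomials.
Variable n : nat.
Local Notation P := {mpoly 'F_2[n]}.
Implicit Types (X Y M : seq nat) (F G : P).

Definition mon X : 'X_{1..n} := [multinom nth 0%N X i | i < n].
Definition exps (m : 'X_{1..n}) : seq nat := multinom_val m.

Lemma monE X i : mon X i = nth 0%N X i.
Proof. by rewrite mnmE. Qed.

Lemma size_exps m : size (exps m) = n.
Proof. exact: size_tuple. Qed.

Lemma expsK m : mon (exps m) = m.
Proof. by apply/mnmP => i; rewrite monE -tnth_nth. Qed.

Lemma mon_inj X Y : size X = n -> size Y = n -> mon X = mon Y -> X = Y.
Proof.
move=> sX sY XY; apply: (@eq_from_nth _ 0%N) => [|i]; first by rewrite sX sY.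
rewrite sX => i_n; have /mnmP/(_ (Ordinal i_n)) := XY; by rewrite !monE.
Qed.

Lemma mdeg_mon X : size X = n -> mdeg (mon X) = sumn X.
Proof.
move=> sX; rewrite mdegE sumnE (big_nth 0%N) sX big_mkord.
by apply: eq_bigr => i _; rewrite monE.
Qed.

Lemma char2_mpoly F : F + F = 0.
Proof.
rewrite -mulr2n -scaler_nat; have -> : (2%:R : 'F_2) = 0 by exact/val_inj.
by rewrite scale0r.
Qed.

Lemma oppr_mpoly F : - F = F.
Proof. by apply/eqP; rewrite eq_sym -addr_eq0 char2_mpoly. Qed.

Lemma mulrn_odd F c : F *+ c = if odd c then F else 0.
Proof.
rewrite -{1}(odd_double_half c) mulrnDr -mul2n mulrnA mulr2n char2_mpoly mul0rn.
by rewrite addr0; case: (odd c).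
Qed.

Lemma F2_cases (c : 'F_2) : c = 0 \/ c = 1.
Proof. by case: c => [[|[|//]] p]; [left | right]; exact/val_inj. Qed.

Definition square_factor F : {poly P} := F%:P + (F ^+ 2)%:P * 'X.

Lemma coef_square_factor F a j :
  ((square_factor F) ^+ a)`_j = if odd 'C(a, j) then F ^+ (a + j) else 0.
Proof.
have -> : square_factor F ^+ a = \poly_(i < a.+1) (F ^+ (a + i) *+ 'C(a, i)).
  rewrite exprDn poly_def; apply: eq_bigr => i _; rewrite exprMn -!polyC_exp.
  rewrite mulrA -polyCM -exprM -exprD mul_polyC scalerMnl.
  by congr ((_ ^+ _ *+ _) *: _); move: (ltn_ord i); lia.
rewrite coef_poly ltnS mulrn_odd; case: leqP => // aj.
by rewrite bin_small.
Qed.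

(** Stated for a family v indexed by all natural numbers, because the induction on M shifts the
    variables. *)
Lemma coef_square_prod k M (v : nat -> P) :
  (\prod_(i < size M) (square_factor (v i)) ^+ nth 0%N M i)`_k
  = \sum_(Y <- sq_terms k M) \prod_(i < size M) v i ^+ nth 0%N Y i.
Proof.
elim: M k v => [|a M IHM] k v /=.
  rewrite big_ord0 coef1; case: k => [|k]; last by rewrite big_nil.
  by rewrite big_seq1 big_ord0.
rewrite big_ord_recl /= coefM big_flatten /= big_map up_stepsE big_filter.
(* The coefficient of the product is a sum over j <= k, the recursion of [sq_terms] one over j <= a;
   both are widened to the common range j <= a + k. *)
transitivity (\sum_(0 <= j < (a + k).+1 | odd 'C(a, j) && (j <= k)%N)
   v 0%N ^+ (a + j) * \sum_(Y <- sq_terms (k - j) M)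
      \prod_(i < size M) v i.+1 ^+ nth 0%N Y i).
  rewrite -(big_mkord predT (fun j => ((square_factor (v 0%N)) ^+ a)`_j *
     (\prod_(i < size M) square_factor (v (lift ord0 i)) ^+ nth 0%N M i)`_(k - j))).
  rewrite (big_nat_widen _ _ (a + k).+1) ?ltnS ?leq_addl //.
  rewrite big_mkcond [RHS]big_mkcond; apply: eq_bigr => j _ /=.
  rewrite ltnS; case: (j <= k)%N; last by rewrite andbF.
  rewrite andbT coef_square_factor (IHM _ (fun i => v i.+1)).
  by case: ifP => //; rewrite mul0r.
have -> : iota 0 a.+1 = index_iota 0 a.+1 by rewrite /index_iota subn0.
rewrite (big_nat_widen _ _ (a + k).+1) ?ltnS ?leq_addr //.
rewrite big_mkcond [RHS]big_mkcond; apply: eq_bigr => j _ /=.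
rewrite ltnS; case: (leqP j a) => ja; last by rewrite bin_small.
rewrite andbT; case: odd => //=.
case: (leqP j k) => jk; last by move/Nat.leb_gt: (elimT ltP jk) => ->; rewrite big_nil.
move/leP/Nat.leb_le: jk => ->; rewrite big_map mulr_sumr.
by apply: eq_bigr => Y _; rewrite big_ord_recl.
Qed.

Definition nth_var (i : nat) : P :=
  if (insub i : option 'I_n) is Some j then 'X_j else 0.

Lemma nth_varE (i : 'I_n) : nth_var i = 'X_i.
Proof. by rewrite /nth_var valK. Qed.

Lemma Sq_mon k M : size M = n ->
  Sq k 'X_[mon M] = \sum_(Y <- sq_terms k M) 'X_[mon Y] :> P.
Proof.
move=> sM; rewrite /Sq mpolyXE_id {1}/total_square rmorph_prod /=.
transitivity ((\prod_(i < size M)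
   (square_factor (nth_var i)) ^+ nth 0%N M i)`_k).
  apply: (congr1 (fun p : {poly P} => p`_k)); rewrite sM; apply: eq_bigr => i _.
  by rewrite rmorphXn /= mmapX mmap1U nth_varE monE.
rewrite coef_square_prod; apply: eq_bigr => Y _.
by rewrite [RHS]mpolyXE_id sM; apply: eq_bigr => i _; rewrite nth_varE monE.
Qed.

End SqMonomials.

(** * Functionals that vanish on hit elements *)

Lemma get_leaf A p : get p (@Leaf A) = None. Proof. by case: p. Qed.

Lemma get_alter A (f : option A -> option A) p q t :
  get p (alter f q t) = if p == q then f (get q t) else get p t.
Proof.
elim: q p t => [|b q IHq] [|c p] t; first by case: t.
- by case: t => [|v l r] //; case: c; case: p.
- by case: t => [|v l r] //; case: b.
rewrite eqseq_cons; case: t => [|v l r] /=.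
  by case: b c => [] [] //=; rewrite ?IHq ?get_leaf.
by case: b c => [] [] //=; rewrite IHq.
Qed.

Lemma unary_cons x X : unary (x :: X) = nseq x true ++ false :: unary X.
Proof. by elim: x => //= x ->. Qed.

Lemma unary_inj : injective unary.
Proof.
elim=> [|x X IHX] [|y Y]; rewrite ?unary_cons; [by []|by case: y|by case: x|].
elim: x y => [|x IHx] [|y] //= []; first by move/IHX->.
by move/IHx => [-> ->].
Qed.

Lemma is_empty_get A (t : trie A) p : is_empty t -> get p t = None.
Proof.
elim: t p => [|v l IHl r IHr] p /=; first by rewrite get_leaf.
case: v => //.
by case El: (is_empty l) => // Er; case: p => [|[] p] //=; [apply: IHl | apply: IHr].
Qed.

Definition in_box (ms : seq (seq bool)) (M : seq nat) := all2 (nth false) ms M.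

Lemma get_toggle_box ms M t : size ms = size M ->
  get (unary M) (toggle_box ms t) =
  if in_box ms M then toggle (get (unary M) t) else get (unary M) t.
Proof.
elim: ms M t => [|m ms IHms] [|a M] t; [by case: t|by []|by []|].
case=> /IHms {}IHms; rewrite unary_cons /=.
elim: m a t => [|b m IHm] [|a] t; rewrite ?nth_nil //=.
  by case: b t => [] [|v l r]; rewrite /= ?IHms ?get_leaf.
by rewrite IHm; case: t => [|v l r]; rewrite /= ?get_leaf.
Qed.

Lemma get_toggle_set X S :
  (get (unary X) (toggle_set S) : bool) = odd (count_mem X S).
Proof.
elim: S => [|Y S IHS] /=; first by rewrite get_leaf.
rewrite get_alter (inj_eq unary_inj) eq_sym oddD -IHS.
by case: eqP => [->|_] //=; case: (get _ _).
Qed.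

Section Functional.
Variable n : nat.
Local Notation P := {mpoly 'F_2[n]}.
Implicit Types (X Y M : seq nat) (F G : P) (S : seq (seq nat)).

Definition down_count S M := count (fun X => in_box (map down_mask X) M) S.

Lemma get_dual_squares S M : all (fun X => size X == n) S -> size M = n ->
  (get (unary M) (dual_squares S) : bool) = odd (down_count S M + count_mem M S).
Proof.
move=> + sM; elim: S => [|X S IHS] /=; first by rewrite get_leaf.
case/andP=> [/eqP sX /IHS {}IHS].
rewrite get_toggle_box ?size_map ?sX // get_alter (inj_eq unary_inj) eq_sym.
rewrite /down_count /= -/(down_count S M).
transitivity ((in_box (map down_mask X) M (+) (X == M))
              (+) odd (down_count S M + count_mem M S)); last first.
  by rewrite !oddD !oddb; case: in_box (X == M) (odd _) (odd _) => [] [] [] [].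
rewrite -IHS; case: in_box; case: eqP => [->|_] //=; by case: (get _ _).
Qed.

Lemma killed_even S M : all (fun X => size X == n) S -> size M = n -> killed S ->
  ~~ odd (down_count S M + count_mem M S).
Proof. by move=> ? ? /is_empty_get S0; rewrite -get_dual_squares // S0. Qed.

Lemma size_sq_terms k M Y : Y \in sq_terms k M -> size Y = size M.
Proof.
elim: M k Y => [|a M IHM] [|k] Y //=; try by rewrite inE => /eqP->.
all: case/flattenP=> L /mapP[j _ ->]; case: Nat.leb => //.
all: by case/mapP=> Z /IHM + -> /= => ->.
Qed.

Lemma sumn_sq_terms k M Y : Y \in sq_terms k M -> sumn Y = (k + sumn M)%N.
Proof.
elim: M k Y => [|a M IHM] k Y /=; first by case: k => //; rewrite inE => /eqP->.
case/flattenP=> L /mapP[j _ ->]; case: Nat.leb_spec => // jk.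
case/mapP=> Z /IHM sZ -> /=; rewrite sZ; lia.
Qed.

Lemma count_map_cons (b y : nat) Y (L : seq (seq nat)) :
  count_mem (y :: Y) (map (cons b) L) = ((b == y) * count_mem Y L)%N.
Proof.
rewrite count_map -sum1_count -[in RHS]sum1_count; case: eqP => [->|bNy].
  by rewrite mul1n; apply: eq_bigl => Z /=; rewrite eqseq_cons eqxx.
by rewrite mul0n big1 // => Z /=; rewrite eqseq_cons (introF eqP bNy).
Qed.

(* [in_box (map down_mask Y) M] says that x^Y is a term of some Sq^k(x^M). *)
Lemma in_box_leq M Y : size Y = size M -> in_box (map down_mask Y) M ->
  (sumn M <= sumn Y)%N.
Proof.
elim: M Y => [|a M IHM] [|y Y] //= [] /IHM {}IHM; rewrite nth_down_mask.
by case/andP=> /andP[? _] /IHM; lia.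
Qed.

(** In each coordinate the step is forced to be y - a, so a term occurs at most once, and the steps
    must add up to k. *)
Lemma count_sq_terms k M Y : size Y = size M ->
  count_mem Y (sq_terms k M) =
  (in_box (map down_mask Y) M && (sumn Y == k + sumn M)%N).
Proof.
elim: M k Y => [|a M IHM] k [|y Y] //=; first by case: k.
case=> sYM; rewrite count_flatten sumnE !big_map up_stepsE big_filter.
rewrite nth_down_mask.
have term j : count_mem (y :: Y) (if Nat.leb j k
       then map (cons (a + j)%coq_nat) (sq_terms (k - j)%coq_nat M) else [::])
   = if (j == y - a)%N && (a <= y)%N && (j <= k)%N then
       count_mem Y (sq_terms (k - j) M) else 0%N.
  case: Nat.leb_spec => jk; last by rewrite (_ : (j <= k)%N = false) ?andbF //; lia.
  rewrite count_map_cons (_ : (j <= k)%N); last lia.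
  rewrite andbT (_ : ((a + j)%coq_nat == y) = (j == y - a)%N && (a <= y)%N); last lia.
  by case: (_ && _); rewrite ?mul1n ?mul0n.
under eq_bigr do rewrite term.
case: (leqP a y) => ay; last by rewrite /= big1 // => j _; rewrite andbF.
rewrite andTb; have [oC|noC] := boolP (odd 'C(a, y - a)); last first.
  rewrite big1_seq // => j /andP[oj _]; case: eqP => // jE.
  by rewrite -jE oj in noC.
have ya : (y - a < a.+1)%N.
  by rewrite ltnS leqNgt; apply/negP => /bin_small C0; rewrite C0 in oC.
rewrite big_mkcond (bigD1_seq (y - a)%N) ?mem_iota ?iota_uniq //= oC eqxx /=.
rewrite big1 ?addn0; last by move=> j /negPf->; case: ifP.
case: leqP => yak.
  rewrite IHM //; congr (nat_of_bool (_ && _)); lia.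
apply/esym/eqP; rewrite eqb0; apply/negP => /andP[/(in_box_leq sYM)].
by move=> MY /eqP; lia.
Qed.

Lemma Sq0r k : Sq k (0 : P) = 0.
Proof. by apply: (addrI (Sq k 0)); rewrite -SqD !addr0. Qed.

Lemma Sq_sum k (I : Type) (r : seq I) (F : I -> P) :
  Sq k (\sum_(i <- r) F i) = \sum_(i <- r) Sq k (F i).
Proof. exact: (big_morph (Sq k) (@SqD n k) (Sq0r k)). Qed.

Lemma SqZ k c F : Sq k (c *: F) = c *: Sq k F.
Proof. by case: (F2_cases c) => ->; rewrite ?scale0r ?Sq0r ?scale1r. Qed.

Lemma sq_terms0 M : sq_terms 0 M = [:: M].
Proof.
elim: M => //= a M IHM; rewrite up_stepsE /= bin0 /= IHM.
rewrite (_ : (a + 0)%coq_nat = a) /=; last lia.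
congr cons; have : all (leq 1) [seq j <- iota 1 a | odd 'C(a, j)].
  by apply/allP=> j; rewrite mem_filter mem_iota => /and3P[].
by elim: (filter _ _) => //= -[|j] s IHs.
Qed.

Lemma Sq_mpolyE k F : Sq k F = \sum_(m <- msupp F) F@_m *: Sq k 'X_[m].
Proof. by rewrite {1}(mpolyE F) Sq_sum; apply: eq_bigr => m _; rewrite SqZ. Qed.

Lemma Sq0 F : Sq 0 F = F.
Proof.
rewrite Sq_mpolyE [RHS]mpolyE; apply: eq_bigr => m _; congr (_ *: _).
by rewrite -(expsK m) Sq_mon ?size_exps // sq_terms0 big_seq1.
Qed.

Definition phi S F : 'F_2 := \sum_(X <- S) F@_(mon n X).

Lemma phiD S : {morph phi S : F G / F + G}.
Proof.
by move=> F G; rewrite /phi -big_split; apply: eq_bigr => X _; rewrite mcoeffD.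
Qed.

Lemma phi0 S : phi S 0 = 0.
Proof. by rewrite /phi big1 // => X _; rewrite mcoeff0. Qed.

Lemma phiZ S c F : phi S (c *: F) = c * phi S F.
Proof. by rewrite /phi mulr_sumr; apply: eq_bigr => X _; rewrite mcoeffZ. Qed.

Lemma phi_sum S (I : Type) (r : seq I) (F : I -> P) :
  phi S (\sum_(i <- r) F i) = \sum_(i <- r) phi S (F i).
Proof. exact: (big_morph (phi S) (phiD S) (phi0 S)). Qed.

Lemma F2_natE k : k%:R = (odd k)%:R :> 'F_2.
Proof. by apply/val_inj; rewrite /= !val_Fp_nat // !modn2 oddb. Qed.

Lemma sum_F2 (I : eqType) (r : seq I) (p : pred I) :
  \sum_(i <- r) (p i)%:R = (odd (count p r))%:R :> 'F_2.
Proof.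
rewrite -F2_natE -sum1_count natr_sum [RHS]big_mkcond.
by apply: eq_bigr => i _; case: (p i).
Qed.

Lemma phi_monE S X : all (fun X => size X == n) S -> size X = n ->
  phi S 'X_[mon n X] = (odd (count_mem X S))%:R.
Proof.
move=> /allP sS sX; rewrite -sum_F2; apply: eq_big_seq => Y /sS/eqP sY.
rewrite mcoeffX; congr (_%:R); congr nat_of_bool.
by apply/eqP/eqP => [/mon_inj->|->].
Qed.

Lemma mcoeff_Sq_mon k M Y : size M = n -> size Y = n ->
  (Sq k 'X_[mon n M] : P)@_(mon n Y) =
  (in_box (map down_mask Y) M && (sumn Y == k + sumn M)%N)%:R.
Proof.
move=> sM sY; rewrite Sq_mon // raddf_sum /=.
transitivity ((odd (count_mem Y (sq_terms k M)))%:R : 'F_2); last first.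
  by rewrite count_sq_terms ?sM // oddb.
rewrite -sum_F2; apply: eq_big_seq => Z /size_sq_terms; rewrite sM => sZ.
by rewrite mcoeffX; congr (_%:R); congr nat_of_bool; apply/eqP/eqP => [/mon_inj->|->].
Qed.

Variable d : nat.

Definition degree_set S := all (fun X => (size X == n) && (sumn X == d)) S.

Lemma degree_set_size S : degree_set S -> all (fun X => size X == n) S.
Proof. by move/allP=> h; apply/allP=> X /h/andP[]. Qed.

Definition dual_killed S := forall M, size M = n -> (sumn M < d)%N ->
  ~~ odd (down_count S M).

(** A set of degree d contains no M of smaller degree, so there the identity part of the total dual
    square contributes nothing to the parity. *)
Lemma killed_dual S : degree_set S -> killed S -> dual_killed S.
Proof.
move=> hS kS M sM Md; have := killed_even (degree_set_size hS) sM kS.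
rewrite (_ : count_mem M S = 0%N) ?addn0 //; apply/eqP; rewrite -leqn0 leqNgt.
rewrite -has_count; apply/negP => /hasP[X /(allP hS)/andP[_ /eqP dX] /eqP XM].
by move: Md; rewrite -XM dX ltnn.
Qed.

(** Only k = d - deg M can contribute, so the single test on the total dual square controls every
    Sq^k separately. *)
Lemma phi_Sq_mon S k M : degree_set S -> dual_killed S -> (0 < k)%N -> size M = n ->
  phi S (Sq k 'X_[mon n M]) = 0.
Proof.
move=> /allP hS kS k0 sM; rewrite /phi.
have [dk|dk] := eqVneq d (k + sumn M)%N; last first.
  apply: big1_seq => X /andP[_ /hS/andP[/eqP sX /eqP dX]].
  by rewrite mcoeff_Sq_mon // dX (negPf dk) andbF.
transitivity (\sum_(X <- S) (in_box (map down_mask X) M)%:R : 'F_2).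
  apply: eq_big_seq => X /hS/andP[/eqP sX /eqP dX].
  by rewrite mcoeff_Sq_mon // dX dk eqxx andbT.
by rewrite sum_F2 (negPf (kS _ _ _)) // dk -addn1 addnC leq_add2r.
Qed.

Lemma phi_Sq S k F : degree_set S -> dual_killed S -> (0 < k)%N -> phi S (Sq k F) = 0.
Proof.
move=> hS kS k0; rewrite Sq_mpolyE phi_sum big1 // => m _.
by rewrite phiZ -(expsK m) phi_Sq_mon ?size_exps ?mulr0.
Qed.

(** After stripping outer factors Sq^0, which are the identity, a composite of positive total degree
    is a single Sq^k(F) with k > 0. *)
Lemma hit_ind (Q : P -> Prop) :
  (forall c F G, Q F -> Q G -> Q (c *: F + G)) -> Q 0 ->
  (forall k F, (0 < k)%N -> Q (Sq k F)) -> forall F, hit F -> Q F.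
Proof.
move=> QL Q0 QS F [r [c [f [hf ->]]]].
apply: big_ind => // [x y Qx Qy|i _]; first by rewrite -[x]scale1r; apply: QL.
rewrite -[X in Q X]addr0; apply: QL => //.
have [s [G [s0 ->]]] := hf i; elim: s s0 => //= -[|k] s IHs s0; last exact: QS.
by rewrite Sq0; apply: IHs.
Qed.

Lemma phi_hit S F : degree_set S -> dual_killed S -> hit F -> phi S F = 0.
Proof.
move=> hS kS; move: F; apply: hit_ind => [c F G FE GE||k F k0].
- by rewrite phiD phiZ FE GE mulr0 addr0.
- exact: phi0.
exact: phi_Sq.
Qed.

Lemma hit_Sq k F : (0 < k)%N -> hit (Sq k F).
Proof.
move=> k0; exists 1%N, (fun=> 1), (fun=> Sq k F); split; last first.
  by rewrite big_ord1 scale1r.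
by move=> _; exists [:: k], F; rewrite /= addn0.
Qed.

Lemma hitD F G : hit F -> hit G -> hit (F + G).
Proof. by move=> hF hG; rewrite -[F]scale1r; apply: spanP. Qed.

Lemma hit0 : hit (0 : P).
Proof. exact: span0. Qed.

End Functional.

(** * The order and the reduction to the remaining monomials *)

Lemma lexcmp_eqP s t : reflect (s = t) (is_eq (lexcmp s t)).
Proof.
apply: (iffP idP) => [|->]; last by elim: t => //= x t; rewrite Nat.compare_refl.
by elim: s t => [|x s IHs] [|y t] //=; case: Nat.compare_spec => // -> /IHs->.
Qed.

(** The bound on sizes excludes a proper prefix s of t, for which [Lt] comes without a differing
    entry. *)
Lemma lexcmp_ltP s t : is_lt (lexcmp s t) -> (size t <= size s)%N ->
  exists i, [/\ (i < size t)%N, forall j, (j < i)%N -> nth 0%N s j = nth 0%N t j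
               & (nth 0%N s i < nth 0%N t i)%N].
Proof.
elim: s t => [|x s IHs] [|y t] //=; case: Nat.compare_spec => // [->|xy _ _].
  move=> /IHs {}IHs; rewrite ltnS => /IHs[i [it ij ii]].
  by exists i.+1; split=> // -[|j] //=; rewrite ltnS => /ij.
by exists 0%N; split=> //=; apply/ltP.
Qed.

Lemma lexcmp_lt_intro s t i : size s = size t -> (i < size t)%N ->
  (forall j, (j < i)%N -> nth 0%N s j = nth 0%N t j) ->
  (nth 0%N s i < nth 0%N t i)%N -> is_lt (lexcmp s t).
Proof.
elim: s t i => [|x s IHs] [|y t] // [|i] [] sst /=.
  by move=> _ _ xy; case: Nat.compare_spec => //; lia.
rewrite ltnS => it eqj lti; have /= -> := eqj 0%N isT.
rewrite Nat.compare_refl; apply: (IHs _ i) => // j ji.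
by have := eqj j.+1; apply.
Qed.

Lemma lexcmp_trans s t u :
  is_lt (lexcmp s t) -> is_lt (lexcmp t u) -> is_lt (lexcmp s u).
Proof.
elim: s t u => [|x s IHs] [|y t] [|z u] //=.
case: (Nat.compare_spec x y) => // [->|xy _].
  by case: (Nat.compare_spec y z) => // _; apply: IHs.
case: (Nat.compare_spec y z) => // [<-|yz] _.
  by case: Nat.compare_spec => //; lia.
by case: Nat.compare_spec => //; lia.
Qed.

Lemma lexcmp_irr s : is_lt (lexcmp s s) = false.
Proof. by elim: s => //= x s IHs; rewrite Nat.compare_refl. Qed.

Lemma ltn_count (T : eqType) (p q : pred T) s x :
  subpred p q -> x \in s -> q x -> ~~ p x -> (count p s < count q s)%N.
Proof.
move=> pq; elim: s => //= y s IHs; rewrite inE => /orP[/eqP<- qx /negPf->|].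
  by rewrite qx add0n add1n ltnS; apply: sub_count.
move=> xs qx px; have := IHs xs qx px; have := pq y.
by case: (p y) (q y) => [] [] //=; lia.
Qed.

Lemma tdegE X : tdeg X = sumn X.
Proof. by elim: X => //= x X ->. Qed.

Lemma deg41P X : reflect (size X = 5%N /\ sumn X = 41%N) (deg41 X).
Proof.
rewrite /deg41 tdegE; apply: (iffP andP) => -[].
  by move=> /Nat.eqb_eq-> /Nat.eqb_eq->.
by move=> -> ->.
Qed.

Lemma size_add_lists s t : size s = size t -> size (add_lists s t) = size t.
Proof. by elim: s t => [|x s IHs] [|y t] //= [] /IHs->. Qed.

Lemma nth_add_lists s t i : size s = size t ->
  nth 0%N (add_lists s t) i = (nth 0%N s i + nth 0%N t i)%N.
Proof. by elim: s t i => [|x s IHs] [|y t] [|i] //= [] /IHs->. Qed.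

Lemma size_weights X : size (weights X) = 6%N.
Proof.
by elim: X => // x X IHX; rewrite /= size_add_lists // IHX size_bits.
Qed.

Lemma nth_weights X t : (t < 6)%N ->
  nth 0%N (weights X) t = (\sum_(x <- X) odd (x %/ 2 ^ t))%N.
Proof.
move=> t6; elim: X => [|x X IHX] /=; first by rewrite big_nil; case: t t6 => [|[|[|[|[|[]]]]]].
by rewrite nth_add_lists ?size_bits ?size_weights // IHX nth_bits // big_cons.
Qed.

Lemma size_key X : size (key X) = (6 + size X)%N.
Proof. by rewrite size_cat size_weights. Qed.

Lemma keyK X : unkey (key X) = X.
Proof. by rewrite /unkey drop_cat size_weights ltnn subnn drop0. Qed.

Local Notation P := {mpoly 'F_2[5]}.
Local Notation mon5 := (mon 5).

(** From t = 6 on both sides vanish, because exponents are at most 41 < 2^6. *)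
Lemma weight_mon X t : deg41 X -> weight (mon5 X) t = nth 0%N (weights X) t.
Proof.
case/deg41P=> sX dX; rewrite /weight.
have -> : (\sum_(j < 5) odd (mon5 X j %/ 2 ^ t) = \sum_(x <- X) odd (x %/ 2 ^ t))%N.
  by rewrite (big_nth 0%N) sX big_mkord; apply: eq_bigr => i _; rewrite monE.
case: (ltnP t 6) => t6; first by rewrite nth_weights.
rewrite nth_default ?size_weights // big1_seq // => x /= xX.
have x41 : (x <= 41)%N.
  by rewrite -dX sumnE (big_rem x) //= leq_addr.
rewrite divn_small //; apply: (leq_ltn_trans x41).
by apply: (@leq_trans (2 ^ 6)%N) => //; rewrite leq_exp2l.
Qed.

Local Notation omega5 := [:: 3; 3; 2; 1; 1]%N.

Lemma nth_omega t : nth 0%N omega_weights t = wvec omega5 t.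
Proof. by case: t => [|[|[|[|[|[|t]]]]]] //=; rewrite /wvec /= nth_nil. Qed.

Definition low X := deg41 X && low_weight X.

Lemma key_omega_lt X : is_lt (lexcmp (key X) omega_weights) ->
  exists i, [/\ (i < 6)%N,
     forall j, (j < i)%N -> nth 0%N (weights X) j = nth 0%N omega_weights j
   & (nth 0%N (weights X) i < nth 0%N omega_weights i)%N].
Proof.
case/lexcmp_ltP=> [|i [i6 eqj lti]]; first by rewrite size_key.
exists i; move: lti; rewrite /key nth_cat size_weights i6; split=> // j ji.
by have := eqj j ji; rewrite nth_cat size_weights (ltn_trans ji i6).
Qed.

Lemma lowP X : deg41 X ->
  low_weight X <-> lexlt (weight (mon5 X)) (wvec omega5).
Proof.
move=> dX; split=> [/key_omega_lt[i [i6 eqj lti]]|[i [eqj lti]]].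
  exists i; rewrite weight_mon // -nth_omega; split=> // j ji.
  by rewrite weight_mon // -nth_omega eqj.
have i6 : (i < 6)%N.
  rewrite ltnNge; apply/negP => i6; move: lti; rewrite -nth_omega.
  by rewrite [in X in (_ < X)%N]nth_default.
rewrite /low_weight /key; move: lti; rewrite weight_mon // -nth_omega => lti.
have {}eqj j : (j < i)%N -> nth 0%N (weights X) j = nth 0%N omega_weights j.
  by move=> ji; rewrite nth_omega -eqj ?weight_mon.
have : is_lt (lexcmp (weights X) omega_weights).
  by apply: (@lexcmp_lt_intro _ _ i); rewrite ?size_weights.
have : size (weights X) = size omega_weights by rewrite size_weights.
(* Between lists of equal length, [Lt] is decided before the end, so appending the exponents does
   not change it. *)
elim: (weights X) omega_weights => [|x s IHs] [|y t] //= [] /IHs {}IHs.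
by case: Nat.compare_spec.
Qed.

Lemma low_weight_lt X : low X -> monoms_lt omega5 ('X_[mon5 X] : P).
Proof.
case/andP=> dX lX; exists (mon5 X); split=> //; last exact/lowP.
by have [sX mX] := deg41P _ dX; rewrite mdeg_mon // mX /wdeg !big_ord_recl big_ord0.
Qed.

Lemma targetP X : reflect [/\ mdeg (mon5 X) = 41%N, positive_monom (mon5 X),
    weight (mon5 X) =1 wvec omega5 & size X = 5%N] (target X).
Proof.
apply: (iffP and3P) => [[dX /allP pX /lexcmp_eqP wX]|[mX pX wX sX]].
  have [sX mX] := deg41P _ dX; split=> //; first by rewrite mdeg_mon.
    move=> j; rewrite monE; have := pX (nth 0%N X j).
    by rewrite mem_nth ?sX //; case: nth => // /(_ isT).
  by move=> t; rewrite weight_mon // wX nth_omega.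
have dX : deg41 X by apply/deg41P; split=> //; rewrite -mX mdeg_mon.
split=> //.
  apply/(all_nthP 0%N) => i; rewrite sX => i5; have := pX (Ordinal i5).
  by rewrite monE /=; case: nth.
apply/lexcmp_eqP/(@eq_from_nth _ 0%N); rewrite size_weights // => t t6.
by rewrite -weight_mon // wX nth_omega.
Qed.

(** The first difference of two keys lies among the six weights or among the five exponents, which
    are the two clauses of [monom_lt]. *)
Lemma key_lt_monom_lt X Y : deg41 X -> deg41 Y ->
  is_lt (lexcmp (key Y) (key X)) -> monom_lt (mon5 Y) (mon5 X).
Proof.
move=> dX dY; have [sX mX] := deg41P _ dX; have [sY mY] := deg41P _ dY.
case/lexcmp_ltP=> [|i [iX eqj lti]]; first by rewrite !size_key sX sY.
split; first by rewrite !mdeg_mon // mX.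
have eqw j : (j < i)%N -> (j < 6)%N -> nth 0%N (weights Y) j = nth 0%N (weights X) j.
  by move=> /eqj; rewrite !nth_cat !size_weights => + j6; rewrite j6.
case: (ltnP i 6) => i6.
  left; exists i; rewrite !weight_mon //; split=> [j ji|].
    by rewrite !weight_mon // eqw // (ltn_trans _ i6).
  by move: lti; rewrite !nth_cat !size_weights i6.
right; split=> [t|].
  rewrite !weight_mon //; case: (ltnP t 6) => t6; last by rewrite !nth_default ?size_weights.
  by rewrite eqw // (leq_trans t6).
have i5 : (i - 6 < 5)%N by move: iX; rewrite size_key sX; lia.
exists (Ordinal i5); rewrite !monE; split=> [j ji|].
  have jj : (j + 6 < i)%N by move: ji; rewrite ltEord /=; lia.
  have := eqj _ jj; rewrite !nth_cat !size_weights !monE.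
  by rewrite (_ : (j + 6 < 6)%N = false) ?addnK //; lia.
by move: lti; rewrite !nth_cat !size_weights (_ : (i < 6)%N = false) //; lia.
Qed.

Lemma target_lt_key X Y : target X -> target Y ->
  lexlt (fun i => mon5 Y i) (fun i => mon5 X i) -> is_lt (lexcmp (key Y) (key X)).
Proof.
move=> tX tY [i [eqj lti]]; case/and3P: tX => /deg41P[sX _] _ /lexcmp_eqP wX.
case/and3P: tY => /deg41P[sY _] _ /lexcmp_eqP wY; rewrite /key wX wY /=.
apply: (@lexcmp_lt_intro _ _ i); rewrite ?sX ?sY //; last by rewrite -!monE.
move=> j ji; have j5 : (j < 5)%N by apply: ltn_trans (ltn_ord i).
by have := eqj (Ordinal j5); rewrite !monE; apply; rewrite ltEord.
Qed.

(** * Sums of monomials modulo hit elements and lower weight *)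

Definition msum (L : seq (seq nat)) : P := \sum_(Y <- L) 'X_[mon5 Y].
Definition rsum (r : seq (seq nat)) : P := \sum_(z <- r) 'X_[mon5 (unkey z)].

(* In characteristic 2 a congruence F = G is the same as F + G = 0. *)
Definition hit_mod_low (F : P) := exists2 L, all low L & hit (F + msum L).

Lemma hit_mod_low0 : hit_mod_low 0.
Proof. by exists [::] => //; rewrite /msum big_nil addr0; apply: hit0. Qed.

Lemma hit_mod_lowD F G : hit_mod_low F -> hit_mod_low G -> hit_mod_low (F + G).
Proof.
move=> [K lK hK] [L lL hL]; exists (K ++ L); first by rewrite all_cat lK.
by rewrite /msum big_cat addrACA; apply: hitD.
Qed.

(** Keys disappear only in equal pairs, so the sum is preserved for arbitrary lists; sortedness
    concerns the search alone. *)
Lemma rsum_merge r q : rsum (merge_rows r q) = rsum r + rsum q.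
Proof.
rewrite /rsum; elim: r q => [|x r IHr] q /=; first by rewrite big_nil add0r.
elim: q => [|y q IHq]; first by rewrite big_nil addr0.
case E: (lexcmp x y).
- have -> : x = y by apply/lexcmp_eqP; rewrite E.
  by rewrite IHr !big_cons addrACA char2_mpoly add0r.
- by rewrite big_cons IHq !big_cons addrCA.
by rewrite !big_cons IHr big_cons addrA.
Qed.

Lemma row_of_cons Y L : row_of (Y :: L) =
  if low_weight Y then row_of L else merge_rows [:: key Y] (row_of L).
Proof. by []. Qed.

Lemma rsum_row_of L :
  rsum (row_of L) + msum [seq Y <- L | low_weight Y] = msum L.
Proof.
rewrite /msum; elim: L => [|Y L IHL]; first by rewrite /rsum !big_nil addr0.
rewrite row_of_cons [filter _ _]/=; case: ifP => _; rewrite !big_cons -IHL; first by rewrite addrCA.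
by rewrite rsum_merge {1}/rsum big_seq1 keyK addrA.
Qed.

Lemma hit_mod_low_row k M : good_source k M ->
  hit_mod_low (rsum (row_of (sq_terms k M))).
Proof.
case: k => // k /andP[/Nat.eqb_eq sM /Nat.eqb_eq dM].
exists [seq Y <- sq_terms k.+1 M | low_weight Y].
  apply/allP=> Y; rewrite mem_filter => /andP[lY YM]; rewrite /low lY andbT.
  apply/deg41P; rewrite (size_sq_terms YM) (sumn_sq_terms YM); split=> //.
by rewrite rsum_row_of /msum -Sq_mon //; apply: hit_Sq.
Qed.

(** The invariant is silent about the leading term stored at a path, which [certified] inspects
    afterwards. *)
Definition table_ok (tab : trie (seq (seq nat))) :=
  forall p r, get p tab = Some r -> hit_mod_low (rsum r).

Local Arguments merge_rows : simpl never.

Lemma hit_mod_low_direct z ks r : direct_row z ks = Some r ->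
  hit_mod_low (rsum r).
Proof.
elim: ks => //= k ks IHks; case F: (first_row _ _ _) => [q|//] [<-] {IHks r ks}.
elim: (sq_sources k (unkey z)) F => //= M Ms IHMs.
by case: andP => [[_ gM] [<-]|_ /IHMs //]; apply: hit_mod_low_row.
Qed.

Lemma hit_mod_low_find tab z r : table_ok tab -> find_row tab z = Some r ->
  hit_mod_low (rsum r).
Proof.
move=> tok; rewrite /find_row; case E: (get _ _) => [q|].
  by case=> <-; apply: tok E.
exact: hit_mod_low_direct.
Qed.

Lemma table_ok_alter tab p r : table_ok tab -> hit_mod_low (rsum r) ->
  table_ok (alter (fun=> Some r) p tab).
Proof.
by move=> tok hr q r'; rewrite get_alter; case: eqP => [_ [<-]|_ /tok].
Qed.

Local Arguments direct_row : simpl never.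

Lemma reduce_row_ok fuel tab r : table_ok tab -> hit_mod_low (rsum r) ->
  table_ok (reduce_row fuel tab r).1 /\
  hit_mod_low (rsum (reduce_row fuel tab r).2).
Proof.
elim: fuel tab r => [|fuel IHf] tab [|z r] // tok hr.
rewrite [reduce_row _ _ _]/=; case E: (get _ _) => [q|].
  by apply: IHf => //; rewrite rsum_merge; apply: hit_mod_lowD (tok _ _ E).
case F: (direct_row _ _) => [q|] //; have hq := hit_mod_low_direct F.
by apply: IHf; [apply: table_ok_alter | rewrite rsum_merge; apply: hit_mod_lowD].
Qed.

Lemma table_ok_seed tab M : table_ok tab -> table_ok (add_seed tab M).
Proof.
move=> tok; rewrite /add_seed; case: ifP => // gM.
have [] := reduce_row_ok 1000 tok (hit_mod_low_row gM).
by case: reduce_row => tab' [|z r] //= tok' hr; apply: table_ok_alter.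
Qed.

Lemma table_ok_seeds : table_ok seed_table.
Proof.
rewrite /seed_table; have : table_ok Leaf by move=> p r; rewrite get_leaf.
by elim: seeds Leaf => //= M Ms IHMs tab /(@table_ok_seed _ M)/IHMs.
Qed.

Lemma certifiedP tab X : table_ok tab -> certified tab X ->
  exists2 L, all (fun Y => target Y && is_lt (lexcmp (key Y) (key X))) L
  & hit_mod_low ('X_[mon5 X] + msum L).
Proof.
move=> tok; rewrite /certified; case E: (find_row _ _) => [[|z r]|] //.
case/andP=> /lexcmp_eqP zX lt; exists (map unkey r); first by rewrite all_map.
by have := hit_mod_low_find tok E; rewrite /rsum big_cons zX /msum big_map.
Qed.

Lemma mem_pos_monoms m d X : size X = m -> all_pos X -> sumn X = d ->
  X \in pos_monoms m d.
Proof.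
elim: m d X => [|m IHm] d [|x X] //=; first by move=> _ _ <-.
case=> sX /andP[x0 pX] <-; apply/flattenP.
exists (map (cons x) (pos_monoms m (x + sumn X - x)%N)).
  by apply/mapP; exists x => //; rewrite mem_iota; case: x x0 => //= x _; lia.
by apply: map_f; apply: IHm; rewrite // addKn.
Qed.

Local Arguments pos_monoms : simpl never.

Lemma targets_mem X : (X \in targets) = target X.
Proof.
rewrite /targets mem_filter; apply/andb_idr => /and3P[/deg41P[sX dX] pX _].
by apply: mem_pos_monoms.
Qed.

Lemma same_listsP s t : same_lists s t -> s = t.
Proof.
elim: s t => [|X s IHs] [|Y t] //=; case: ifP => // /lexcmp_eqP-> /IHs->.
by [].
Qed.

(** The elimination is rerun as a boolean test, so that conversion only has to reach [true]. *)
Lemma adm_computation : same_lists adm (uncertified seed_table).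
Proof. by vm_cast_no_check (erefl true). Qed.

Lemma adm_uncertified : adm = uncertified seed_table.
Proof. exact: same_listsP adm_computation. Qed.

Lemma adm_target X : X \in adm -> target X.
Proof.
by rewrite adm_uncertified mem_filter targets_mem => /andP[].
Qed.

(** Induction along the order: a monomial outside [adm] is certified, hence congruent to the tail of
    its row, whose terms are strictly smaller targets. The alternative [Y == X] serves the case
    where X is itself in [adm]. *)
Lemma span_adm X : target X ->
  exists2 L, all (fun Y => (Y \in adm) && ((Y == X) || is_lt (lexcmp (key Y) (key X)))) L
  & hit_mod_low ('X_[mon5 X] + msum L).
Proof.
have [m] := ubnP (count (fun Y => is_lt (lexcmp (key Y) (key X))) targets).
elim: m X => // m IHm X; rewrite ltnS => mX tX.
have [Xadm|Xadm] := boolP (X \in adm).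
  exists [:: X]; first by rewrite /= Xadm eqxx.
  by rewrite /msum big_seq1 char2_mpoly; apply: hit_mod_low0.
have /certifiedP : certified seed_table X.
  by move: Xadm; rewrite adm_uncertified mem_filter targets_mem tX andbT negbK.
case=> [|L]; first exact: table_ok_seeds.
suff: all (fun Y => target Y && is_lt (lexcmp (key Y) (key X))) L ->
   exists2 K, all (fun Y => (Y \in adm) && is_lt (lexcmp (key Y) (key X))) K
   & hit_mod_low (msum L + msum K).
  move=> H lL hL; have [K lK hK] := H lL; exists K.
    by apply: sub_all lK => Y /andP[-> ->]; rewrite orbT.
  have := hit_mod_lowD hL hK; congr hit_mod_low.
  by rewrite addrA -[_ + _ + msum L]addrA char2_mpoly addr0.
elim: L => [_|Y L IHL /= /andP[/andP[tY YX] /IHL[K lK hK]]].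
  by exists [::] => //; rewrite /msum big_nil addr0; apply: hit_mod_low0.
have [|K' lK' hK'] := IHm Y _ tY.
  (* The measure drops because Y is itself below X but not below Y. *)
  apply: leq_trans mX; apply: (@ltn_count _ _ _ _ Y) => //.
  - by move=> Z /lexcmp_trans; apply.
  - by rewrite targets_mem.
  by rewrite lexcmp_irr.
exists (K' ++ K).
  rewrite all_cat lK andbT; apply: sub_all lK' => Z /andP[-> /orP[/eqP->|]] //.
  by move/lexcmp_trans; apply.
have := hit_mod_lowD hK' hK; congr hit_mod_low.
by rewrite /msum big_cons big_cat addrACA.
Qed.

(** * Linear algebra over F_2 behind the rank computation *)

Fixpoint dot (r : seq bool) (v : seq 'F_2) : 'F_2 :=
  match r, v with
  | b :: r', x :: v' => b%:R * x + dot r' v'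
  | _, _ => 0
  end.

(** A stored row has an implicit leading 1, whence the equation [x + dot q v' = 0]. Sizes are
    recorded because [dot] truncates silently. *)
Fixpoint annihilates (basis : seq (option (seq bool))) (v : seq 'F_2) : Prop :=
  match basis, v with
  | o :: basis', x :: v' =>
      (if o is Some q then size q = size v' /\ x + dot q v' = 0 else True)
      /\ annihilates basis' v'
  | [::], [::] => True
  | _, _ => False
  end.

Lemma char2_F2 (x : 'F_2) : x + x = 0.
Proof. by case: (F2_cases x) => ->; apply/val_inj. Qed.

Lemma size_xor_lists r q : size r = size q -> size (xor_lists r q) = size q.
Proof. by elim: r q => [|b r IHr] [|c q] //= [] /IHr->. Qed.

Lemma dot_xor r q v : size r = size q -> dot (xor_lists r q) v = dot r v + dot q v.
Proof.
elim: r q v => [|b r IHr] [|c q] [|x v] //=; rewrite ?addr0 // => -[] /IHr->.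
rewrite addrACA -mulrDl; congr (_ * _ + _).
by case: b c => [] []; rewrite /= ?addr0 ?add0r // char2_F2.
Qed.

(** Every row stored during elimination is a sum of rows orthogonal to v. *)
Lemma insert_row_annihilates r basis v : size r = size v -> dot r v = 0 ->
  annihilates basis v -> annihilates (insert_row r basis) v.
Proof.
elim: v r basis => [|x v IHv] [|b r] [|o basis] //= [sr] rv [ho hb].
case: b rv => [|]; rewrite ?mul1r ?mul0r ?add0r => rv; last by split=> //; apply: IHv.
case: o ho => [q [sq qv]|_] /=; last by [].
split=> //; apply: IHv; rewrite ?size_xor_lists ?sr ?sq // dot_xor ?sr ?sq //.
have -> : dot r v = dot q v by apply: (addrI x); rewrite rv qv.
exact: char2_F2.
Qed.

(** With a pivot in every position the system is unitriangular, and back substitution from the last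
    coordinate gives v = 0. *)
Lemma annihilates_full basis v : all isSome basis -> annihilates basis v ->
  all (pred1 0) v.
Proof.
have dot0 r w : all (pred1 0) w -> dot r w = 0.
  elim: w r => [|x w IHw] [|b r] //= /andP[/eqP-> /IHw->]; by rewrite mulr0 addr0.
elim: basis v => [|[q|] basis IHb] [|x v] //= hb [[_ qv] /(IHb _ hb) v0].
by rewrite v0 andbT; move: qv; rewrite dot0 // addr0 => ->.
Qed.

Lemma dotE r v : size r = size v ->
  dot r v = \sum_(j < size v) (nth false r j)%:R * nth 0 v j.
Proof.
elim: r v => [|b r IHr] [|x v] //=; first by rewrite big_ord0.
by case=> /IHr->; rewrite big_ord_recl.
Qed.

(** * The functionals are independent on the remaining monomials *)

Definition selected :=
  flatten [seq [seq (gs.1, s) | s <- gs.2] | gs <- selection].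

Definition inverse (s : seq nat) := [seq index i s | i <- iota 0 5].
(** Evaluating at permuted monomials amounts to moving the support by the inverse permutation. *)
Definition class_of gs := map (permute (inverse gs.2)) (nth [::] dual_classes gs.1).

Lemma size_permute s X : size (permute s X) = size s.
Proof. by rewrite size_map. Qed.

(** The condition on the support makes the functional vanish on monomials lacking a variable and on
    lower weights. *)
Definition good_class (S : seq (seq nat)) :=
  killed S && all (fun X => [&& deg41 X, all_pos X & ~~ low_weight X]) S.

Lemma dual_computation :
  all good_class dual_classes && all isSome (rank_table selection).
Proof. by vm_cast_no_check (erefl true). Qed.

Lemma selected_ok : all (fun gs => (gs.1 < size dual_classes)%N &&
   perm_eq gs.2 (iota 0 5)) selected.
Proof. by vm_cast_no_check (erefl true). Qed.

Lemma size_adm : size adm = 925%N.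
Proof. by vm_cast_no_check (erefl 925%N). Qed.

(** The enumeration of monomials is lexicographic, so the list is strictly increasing. *)
Lemma uniq_adm : uniq adm.
Proof.
have : sorted (fun X Y => is_lt (lexcmp X Y)) adm by vm_cast_no_check (erefl true).
apply: sorted_uniq; first by move=> ? ? ?; apply: lexcmp_trans.
exact: lexcmp_irr.
Qed.

Lemma in_boxP ms M : size ms = size M ->
  reflect (forall i, (i < size M)%N -> nth false (nth [::] ms i) (nth 0%N M i))
          (in_box ms M).
Proof.
elim: ms M => [|m ms IHms] [|a M] //=; first by constructor.
case=> /IHms {}IHms; apply: (iffP andP) => [[ma /IHms msM] [|i] //|h].
  exact: msM.
by split; [apply: (h 0%N) | apply/IHms => i /(h i.+1)].
Qed.

Section Permute.
Variable s : seq nat.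
Hypothesis s5 : perm_eq s (iota 0 5).

Let size_s : size s = 5%N. Proof. by rewrite (perm_size s5) size_iota. Qed.
Let uniq_s : uniq s. Proof. by rewrite (perm_uniq s5) iota_uniq. Qed.
Let mem_s i : (i \in s) = (i < 5)%N. Proof. by rewrite (perm_mem s5) mem_iota. Qed.

Lemma nth_permute X i : (i < 5)%N -> nth 0%N (permute s X) i = nth 0%N X (nth 0%N s i).
Proof. by move=> i5; rewrite (nth_map 0%N) ?size_s. Qed.

Lemma nth_permute_inverse X i : (i < 5)%N ->
  nth 0%N (permute (inverse s) X) i = nth 0%N X (index i s).
Proof.
by move=> i5; rewrite (nth_map 0%N) ?size_map ?size_iota // (nth_map 0%N) ?size_iota // nth_iota.
Qed.

Lemma size_permute_inverse X : size (permute (inverse s) X) = 5%N.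
Proof. by rewrite !size_map size_iota. Qed.

Lemma permuteK X : size X = 5%N -> permute (inverse s) (permute s X) = X.
Proof.
move=> sX; apply: (@eq_from_nth _ 0%N); rewrite size_permute_inverse // => i i5.
rewrite nth_permute_inverse // nth_permute ?nth_index ?mem_s //.
by rewrite -size_s index_mem mem_s.
Qed.

Lemma permuteVK X : size X = 5%N -> permute s (permute (inverse s) X) = X.
Proof.
move=> sX; apply: (@eq_from_nth _ 0%N); rewrite size_permute ?size_s // => i i5.
rewrite nth_permute // nth_permute_inverse; last by rewrite -mem_s mem_nth ?size_s.
by rewrite index_uniq ?size_s.
Qed.

Lemma perm_permute X : size X = 5%N -> perm_eq (permute (inverse s) X) X.
Proof.
move=> sX; rewrite perm_sym -{1}(permuteVK sX) /permute -[X in perm_eq _ X](mkseq_nth 0%N).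
by rewrite size_permute_inverse; apply: perm_map.
Qed.

(** The squares commute with permutations of the variables. *)
Lemma in_box_permute X M : size X = 5%N -> size M = 5%N ->
  in_box (map down_mask (permute (inverse s) X)) M =
  in_box (map down_mask X) (permute s M).
Proof.
move=> sX sM; apply/in_boxP/in_boxP.
- by rewrite !size_map size_iota sM.
- by rewrite !size_map size_s sX.
- rewrite sM size_permute size_s => h i i5; rewrite nth_permute // (nth_map 0%N) ?sX //.
  have si : (nth 0%N s i < 5)%N by rewrite -mem_s mem_nth ?size_s.
  have := h _ si; rewrite (nth_map 0%N) ?size_permute_inverse //.
  by rewrite nth_permute_inverse // index_uniq ?size_s.
rewrite sM size_permute size_s => h i i5; rewrite (nth_map 0%N) ?size_permute_inverse //.
have si : (index i s < 5)%N by rewrite -size_s index_mem mem_s.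
have := h _ si; rewrite (nth_map 0%N) ?sX // nth_permute // nth_index ?mem_s //.
by rewrite nth_permute_inverse.
Qed.

End Permute.

Lemma selectedP gs : gs \in selected ->
  [/\ perm_eq gs.2 (iota 0 5), good_class (nth [::] dual_classes gs.1)
    & all (fun X => size X == 5%N) (nth [::] dual_classes gs.1)].
Proof.
move/(allP selected_ok)/andP=> [gl gs5].
have /andP[/allP good _] := dual_computation.
have gd : good_class (nth [::] dual_classes gs.1) by apply: good; apply: mem_nth.
split=> //; have /andP[_ /allP gg] := gd; apply/allP=> X /gg/and3P[].
by case/deg41P=> ->.
Qed.

(** Being killed, degree, positivity and weight are all invariant under permutation, so checking one
    class settles its orbit. *)
Lemma class_ofP gs : gs \in selected ->
  [/\ degree_set 5 41 (class_of gs), dual_killed 5 41 (class_of gs)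
    & all (fun X => all_pos X && ~~ low X) (class_of gs)].
Proof.
case/selectedP=> s5 /andP[kS /allP gS] /allP sS.
have dS : degree_set 5 41 (nth [::] dual_classes gs.1).
  by apply/allP=> X /gS/and3P[/deg41P[-> ->]].
split.
- apply/allP=> _ /mapP[X XS ->]; have /eqP sX := sS X XS.
  rewrite size_permute_inverse eqxx (perm_sumn (perm_permute s5 sX)).
  by have /andP[] := allP dS X XS.
- move=> M sM dM; rewrite /down_count count_map.
  have sP : size (permute gs.2 M) = 5%N by rewrite size_permute (perm_size s5) size_iota.
  have dP : (sumn (permute gs.2 M) < 41)%N.
    by rewrite -(perm_sumn (perm_permute s5 sP)) permuteK.
  have := killed_dual dS kS sP dP; congr (~~ odd _).
  apply: eq_in_count => X /sS/eqP sX.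
  rewrite -[RHS]/(in_box (map down_mask (permute (inverse gs.2) X)) M).
  by rewrite in_box_permute.
apply/allP=> _ /mapP[X XS ->]; have /eqP sX := sS X XS.
have /and3P[dX pX lX] := gS X XS; have pXX := perm_permute s5 sX.
rewrite /all_pos (perm_all _ pXX) -/(all_pos X) pX /=.
apply: contra lX => /andP[dPX /(lowP dPX)[i [eqj lti]]]; apply/(lowP dX).
have W t : weight (mon5 (permute (inverse gs.2) X)) t = weight (mon5 X) t.
  rewrite !weight_mon //; case: (ltnP t 6) => t6.
    by rewrite !nth_weights //; apply: perm_big.
  by rewrite !nth_default ?size_weights.
by exists i; rewrite -W; split=> // j ji; rewrite -W eqj.
Qed.

Lemma value_class_of gs Z : gs \in selected -> size Z = 5%N ->
  (get (unary (permute gs.2 Z)) (toggle_set (nth [::] dual_classes gs.1)) : bool) =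
  odd (count_mem Z (class_of gs)).
Proof.
case/selectedP=> s5 _ /allP sS sZ; rewrite get_toggle_set count_map; congr odd.
apply: eq_in_count => X /sS/eqP sX; apply/eqP/eqP => [->|/= <-].
  exact: permuteK.
by rewrite permuteVK.
Qed.

Definition rows : seq (seq bool) :=
  [seq values (toggle_set (nth [::] dual_classes gs.1)) gs.2 adm | gs <- selected].

Lemma rank_tableE :
  rank_table selection = foldl (fun b r => insert_row r b) (nseq (size adm) None) rows.
Proof.
rewrite /rank_table /rows /selected; elim: selection (nseq _ _) => //= gs l IHl b.
rewrite IHl map_cat foldl_cat; congr foldl.
by elim: gs.2 b => //= s ss IHs b; rewrite IHs.
Qed.

(** Full column rank: no nontrivial combination of the monomials in [adm] is killed by all selected
    functionals. *)
Lemma rows_independent v : size v = size adm ->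
  (forall r, r \in rows -> dot r v = 0) -> all (pred1 0) v.
Proof.
move=> sv rv; have /andP[_] := dual_computation; rewrite rank_tableE => /annihilates_full.
apply; have srows r : r \in rows -> size r = size v.
  by case/mapP=> gs _ ->; rewrite size_map sv.
have : annihilates (nseq (size adm) None) v.
  by rewrite -sv; elim: (v) => //= x w IHw.
elim: rows (nseq _ _) rv srows => //= r R IHR b rv srows bv.
apply: IHR => [q qR|q qR|]; [apply: rv|apply: srows|]; rewrite ?inE ?qR ?orbT //.
by apply: insert_row_annihilates => //; [apply: srows|apply: rv]; rewrite inE eqxx.
Qed.

Local Opaque adm selected dual_classes.


(** * The functionals assembled into one linear map *)

Local Notation N := (size adm).
Local Notation K := (size selected).

Definition Phi (F : P) : 'rV['F_2]_K :=
  \row_i phi (class_of (nth (0%N, [::]) selected i)) F.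

Lemma PhiD : {morph Phi : F G / F + G}.
Proof. by move=> F G; apply/rowP=> i; rewrite !mxE phiD. Qed.

Lemma PhiZ c F : Phi (c *: F) = c *: Phi F.
Proof. by apply/rowP=> i; rewrite !mxE phiZ. Qed.

Lemma Phi0 : Phi 0 = 0.
Proof. by apply/rowP=> i; rewrite !mxE phi0. Qed.

Lemma Phi_msum L : Phi (msum L) = \sum_(Y <- L) Phi 'X_[mon5 Y].
Proof. exact: (big_morph Phi PhiD Phi0). Qed.

Lemma nth_selected (i : 'I_K) : nth (0%N, [::]) selected i \in selected.
Proof. exact: mem_nth. Qed.

Lemma Phi_hit F : hit F -> Phi F = 0.
Proof.
move=> hF; apply/rowP=> i; rewrite !mxE.
by have [dS kS _] := class_ofP (nth_selected i); exact: (phi_hit dS kS hF).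
Qed.

Lemma Phi_vanish X : size X = 5%N -> ~~ all_pos X || low X -> Phi 'X_[mon5 X] = 0.
Proof.
move=> sX bad; apply/rowP=> i; rewrite !mxE.
have [dS _ /allP gS] := class_ofP (nth_selected i).
rewrite phi_monE ?(degree_set_size dS) // (count_memPn _) //; apply/negP=> /gS.
by move: bad; case: all_pos; case: low.
Qed.

Lemma Phi_hit_mod_low F : hit_mod_low F -> Phi F = 0.
Proof.
case=> L /allP lL /Phi_hit; rewrite PhiD Phi_msum big1_seq ?addr0 // => Y /andP[_ /lL lY].
have /andP[/deg41P[sY _] _] := lY.
by rewrite Phi_vanish // lY orbT.
Qed.

Definition adm_nth (j : 'I_N) := nth [::] adm j.

Lemma adm_nth_mem j : adm_nth j \in adm.
Proof. exact: mem_nth. Qed.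

Lemma size_target X : target X -> size X = 5%N.
Proof. by case/and3P=> /deg41P[]. Qed.

Definition adm_matrix : 'M['F_2]_(N, K) := \matrix_j Phi 'X_[mon5 (adm_nth j)].

Lemma adm_matrix_inj (u : 'rV_N) : u *m adm_matrix = 0 -> u = 0.
Proof.
move=> uA; pose v := [seq u 0 j | j <- enum 'I_N].
have sv : size v = N by rewrite size_map size_enum_ord.
have vE (j : 'I_N) : nth 0 v j = u 0 j.
  by rewrite (nth_map j) ?size_enum_ord // nth_ord_enum.
have /allP v0 : all (pred1 0) v.
  apply: rows_independent => // _ /(nthP [::])[i + <-]; rewrite size_map => iK.
  have /rowP/(_ (Ordinal iK)) := uA; rewrite !mxE => <-.
  rewrite (nth_map (0%N, [::])) // dotE; last by rewrite sv size_map.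
  rewrite sv.
  apply: eq_bigr => j _; rewrite !mxE vE mulrC.
  have gsS : nth (0%N, [::]) selected i \in selected by apply: mem_nth.
  have [dS _ _] := class_ofP gsS.
  have sj := size_target (adm_target (adm_nth_mem j)).
  rewrite phi_monE ?(degree_set_size dS) // -value_class_of //.
  by rewrite (nth_map [::]) // /adm_nth; case: (get _ _).
apply/rowP=> j; rewrite mxE -vE; apply/eqP/v0/mem_nth; by rewrite sv.
Qed.


(** * Admissibility and the dimension *)

Lemma target_deg X : target X -> deg41 X. Proof. by case/and3P. Qed.

Lemma adm_index X : X \in adm -> {j : 'I_N | X = adm_nth j}.
Proof.
move=> Xa; have iN : (index X adm < N)%N by rewrite index_mem.
by exists (Ordinal iN); rewrite /adm_nth /= nth_index.
Qed.

Lemma sub_mpoly (F G : P) : F - G = F + G.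
Proof. by rewrite oppr_mpoly. Qed.

(** If X were congruent to a sum of smaller monomials, [Phi] of X would be a combination of rows of
    [adm_matrix] other than the row of X, against their independence. The predicate [B] expresses
    such a combination. *)
Lemma adm_admissible X : X \in adm -> admissible (mon5 X).
Proof.
move=> Xa [s [lts hits]]; have tX := adm_target Xa; have dX := target_deg tX.
have [j0 XE] := adm_index Xa.
pose B F := exists2 c : 'rV_N, c 0 j0 = 0 & Phi F = c *m adm_matrix.
have B0 F : Phi F = 0 -> B F.
  by move=> F0; exists 0; rewrite ?mxE // mul0mx.
have BD F G : B F -> B G -> B (F + G).
  move=> [c c0 Fc] [d d0 Gd]; exists (c + d); first by rewrite mxE c0 d0 addr0.
  by rewrite PhiD Fc Gd mulmxDl.
have Badm Y : Y \in adm -> Y != X -> B 'X_[mon5 Y].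
  move=> /adm_index[j ->] jX; exists (delta_mx 0 j).
    rewrite mxE eqxx /=; case: eqP => // jj; case/eqP: jX.
    by rewrite XE jj.
  by rewrite -rowE rowK.
have Bmsum L : all (fun Y => (Y \in adm) && (Y != X)) L -> B (msum L).
  elim: L => [_|Y L IHL /= /andP[/andP[Ya YX] /IHL BL]].
    by apply: B0; rewrite /msum big_nil Phi0.
  by rewrite /msum big_cons; apply: BD => //; apply: Badm.
have Blt Y : monom_lt Y (mon5 X) -> B 'X_[Y].
  have [_ _ wX sX] := targetP _ tX.
  rewrite -(expsK Y); set y := exps Y => -[mY ltY].
  have sy : size y = 5%N by apply: size_exps.
  have dy : deg41 y.
    apply/deg41P; split=> //; rewrite -(mdeg_mon sy) mY mdeg_mon //.
    by case: (deg41P _ dX).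
  case: ltY => [[i [eqi lti]]|[wY ltY]].
    (* A smaller monomial of lower weight, or below one lacking a variable, is invisible to [Phi];
       what remains is a smaller target. *)
    apply/B0/Phi_vanish => //; apply/orP; right; rewrite /low dy; apply/lowP => //.
    by exists i; rewrite -wX; split=> // j ji; rewrite -wX eqi.
  have [py|py] := boolP (all_pos y); last by apply/B0/Phi_vanish; rewrite ?py.
  have ty : target y.
    rewrite /target dy py; apply/lexcmp_eqP/(@eq_from_nth _ 0%N).
      by rewrite size_weights.
    by rewrite size_weights => t t6; rewrite -weight_mon // wY wX nth_omega.
  have yX := target_lt_key tX ty ltY.
  have [L lL hL] := span_adm ty.
  have -> : 'X_[mon5 y] = ('X_[mon5 y] + msum L) + msum L :> P.
    by rewrite -addrA char2_mpoly addr0.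
  apply: BD; first by apply/B0/Phi_hit_mod_low.
  (* The expansion of y involves only monomials at most y, hence below X, so the row of X does not
     occur. *)
  apply: Bmsum; apply: sub_all lL => Z /andP[-> /orP ZX] /=.
  apply/eqP=> ZE; have : is_lt (lexcmp (key Z) (key X)).
    by case: ZX => [/eqP->|ZY] //; apply: lexcmp_trans yX.
  by rewrite ZE lexcmp_irr.
have Bs : B (\sum_(Y <- s) 'X_[Y]).
  elim: s lts {hits} => [_|Y s IHs lts]; first by apply: B0; rewrite big_nil Phi0.
  rewrite big_cons; apply: BD; first by apply/Blt/lts; rewrite inE eqxx.
  by apply: IHs => Z Zs; apply: lts; rewrite inE Zs orbT.
have [c c0 Phic] : B 'X_[mon5 X].
  have -> : 'X_[mon5 X] = ('X_[mon5 X] - \sum_(Y <- s) 'X_[Y]) + \sum_(Y <- s) 'X_[Y] :> P.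
    by rewrite subrK.
  by apply: BD Bs; apply/B0/Phi_hit.
have : (delta_mx 0 j0 - c) *m adm_matrix = 0.
  by rewrite mulmxBl -Phic -rowE rowK XE subrr.
move/adm_matrix_inj/rowP/(_ j0); rewrite !mxE c0 !eqxx /= subr0.
by move/eqP; rewrite oner_eq0.
Qed.

Lemma inadmissible_target X : target X -> X \notin adm -> inadmissible (mon5 X).
Proof.
move=> tX Xa; have [L /allP lL [K /allP lK hLK]] := span_adm tX.
have [_ _ wX _] := targetP _ tX; have dX := target_deg tX.
(* The low terms K belong to the witness too: their smaller weight puts them below X. *)
exists (map mon5 (L ++ K)); split; last first.
  rewrite /hit_equiv sub_mpoly big_map big_cat addrA; exact: hLK.
move=> _ /mapP[Y + ->]; rewrite mem_cat => /orP[/lL/andP[Ya /orP[/eqP YX|YX]]|/lK].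
- by rewrite -YX Ya in Xa.
- by apply: key_lt_monom_lt YX => //; apply/target_deg/adm_target.
case/andP=> dY /(lowP dY)[i [eqi lti]]; split.
  have [sX mX] := deg41P _ dX; have [sY mY] := deg41P _ dY.
  by rewrite !mdeg_mon // mX.
by left; exists i; rewrite wX; split=> // j ji; rewrite wX eqi.
Qed.

(** For a spanning family, independence may be tested on its images under a linear map f to row
    vectors, which avoids arguing inside an abstract quotient. *)
Lemma has_dim_coordinates (n : nat) (W : lmodType 'F_2) (b : 'I_n -> W) m
    (f : W -> 'rV['F_2]_m) :
  (forall c x y, f (c *: x + y) = c *: f x + f y) ->
  (forall w, exists c : 'rV_n, w = \sum_j c 0 j *: b j) ->
  (forall c : 'rV_n, \sum_j c 0 j *: f (b j) = 0 -> c = 0) -> has_dim W n.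
Proof.
move=> fL span free.
have f0 : f 0 = 0 by have := fL (-1) 0 0; rewrite scaler0 addr0 scaleN1r addNr.
have fsum (c : 'rV_n) : f (\sum_j c 0 j *: b j) = \sum_j c 0 j *: f (b j).
  have fD : {morph f : x y / x + y}.
    by move=> x y; rewrite -[x in f (x + _)]scale1r fL scale1r.
  rewrite (big_morph f fD f0); apply: eq_bigr => j _.
  by rewrite -[X in f X]addr0 fL f0 addr0.
pose g (c : 'rV_n) : W := \sum_j c 0 j *: b j.
have gL a c d : g (a *: c + d) = a *: g c + g d.
  rewrite /g scaler_sumr -big_split; apply: eq_bigr => j _.
  by rewrite !mxE scalerDl scalerA.
have gI c d : g c = g d -> c = d.
  move=> cd; apply/eqP; rewrite -subr_eq0; apply/eqP/free.
  rewrite -fsum -/(g _) -scaleN1r addrC gL cd scaleN1r addNr; exact: f0.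
(* Coordinates are obtained by choice; injectivity of g makes them unique and therefore linear. *)
pose h w : 'rV_n := projT1 (cid (span w)).
have hK : cancel h g by move=> w; rewrite /h /g; case: cid => c /=.
have gK : cancel g h by move=> c; apply: gI; rewrite hK.
constructor; exists h; last by exists g.
by move=> a x y; apply: gI; rewrite gL !hK.
Qed.

(** * The quotient attached to omega and its basis *)

Definition ple (F : P) : P_le 5 omega5 := insubd 0 F.

Definition in_le (F : P) := F \in in_span (@monoms_le 5 omega5).

(** Outside the subspace [ple] takes the default value 0, whence the membership hypotheses in the
    lemmas on classes. *)
Lemma pleK F : in_le F -> val (ple F) = F.
Proof. by move=> hF; rewrite val_insubd; rewrite /in_le in hF; rewrite hF. Qed.

Lemma in_le_mon X : target X || low X -> in_le 'X_[mon5 X].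
Proof.
move=> tX; apply/in_spanP; exists 1%N, (fun=> 1), (fun=> 'X_[mon5 X]).
split; last by rewrite big_ord1 scale1r.
move=> _; exists (mon5 X); have d : wdeg omega5 = 41%N.
  by rewrite /wdeg !big_ord_recl big_ord0.
rewrite d; case/orP: tX => [/targetP[-> _ wX _]|/andP[dX lX]]; split=> //.
- by right.
- by have [sX <-] := deg41P _ dX; rewrite mdeg_mon.
by left; apply/lowP.
Qed.

Lemma in_le_msum L : all (fun X => target X || low X) L -> in_le (msum L).
Proof.
move=> /allP lL; rewrite /in_le /msum big_seq; apply: rpred_sum => X /lL.
exact: in_le_mon.
Qed.

Lemma lspan_gen (V : lmodType 'F_2) (S : V -> Prop) v : S v -> lspan S v.
Proof.
move=> Sv; exists 1%N, (fun=> 1), (fun=> v); split=> //.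
by rewrite big_ord1 scale1r.
Qed.

Definition rel_le (F : P_le 5 omega5) :=
  hit (val F) \/ lspan (@monoms_lt 5 omega5) (val F).

Definition qclass (F : P) : Q_weight 5 omega5 := quotient_class rel_le (ple F).

Lemma lspan_lt_msum K : all low K -> lspan (@monoms_lt 5 omega5) (msum K).
Proof.
elim: K => [_|Y K IHK /= /andP[lY /IHK hK]]; first by rewrite /msum big_nil; apply: span0.
rewrite /msum big_cons -['X_[mon5 Y]]scale1r; apply: spanP hK.
exact/lspan_gen/low_weight_lt.
Qed.

Lemma qclass_hit_mod_low F G : in_le F -> in_le G -> hit_mod_low (F + G) ->
  qclass F = qclass G.
Proof.
move=> lF lG [K lK hK]; apply/quotient_classP.
have lmK : in_le (msum K).
  by apply: in_le_msum; apply: sub_all lK => X ->; rewrite orbT.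
(* In characteristic 2 the difference splits into a hit part and a part of lower weight, both inside
   the subspace, as the relations require. *)
have -> : ple F - ple G = 1 *: ple (F + G + msum K) + ple (msum K).
  apply: val_inj; rewrite scale1r raddfB raddfD /= !pleK //; last first.
    by rewrite /in_le !rpredD.
  by rewrite sub_mpoly -addrA char2_mpoly addr0.
apply: spanP; apply: lspan_gen; [left|right]; rewrite pleK //.
  by rewrite /in_le !rpredD.
exact: lspan_lt_msum.
Qed.

Lemma qclass0 : qclass 0 = 0.
Proof.
rewrite /qclass; have -> : ple 0 = 0 by apply: val_inj; rewrite pleK ?raddf0 // /in_le rpred0.
by apply: (addrI (quotient_class rel_le 0)); rewrite -quotient_classD !addr0.
Qed.

Lemma qclassD F G : in_le F -> in_le G -> qclass (F + G) = qclass F + qclass G.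
Proof.
move=> lF lG; rewrite /qclass -quotient_classD; congr quotient_class.
by apply: val_inj; rewrite raddfD /= !pleK // /in_le rpredD.
Qed.

Lemma qclass_msum L : all (fun X => target X || low X) L ->
  qclass (msum L) = \sum_(X <- L) qclass 'X_[mon5 X].
Proof.
elim: L => [_|X L IHL /= /andP[tX tL]]; first by rewrite /msum !big_nil qclass0.
rewrite /msum !big_cons qclassD ?in_le_mon //; last exact: in_le_msum.
by congr (_ + _); apply: IHL.
Qed.

Local Notation Q := (Q_weight 5 omega5).

Section Combinations.
Variables (W : lmodType 'F_2) (n : nat) (b : 'I_n -> W).

Definition combinations (x : W) := exists c : 'rV_n, x = \sum_j c 0 j *: b j.

Lemma combinationsP a x y :
  combinations x -> combinations y -> combinations (a *: x + y).
Proof.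
move=> [c ->] [d ->]; exists (a *: c + d); rewrite scaler_sumr -big_split.
by apply: eq_bigr => j _; rewrite !mxE scalerDl scalerA.
Qed.

Lemma combinations0 : combinations 0.
Proof. by exists 0; rewrite big1 // => j _; rewrite mxE scale0r. Qed.

Lemma combinationsD x y : combinations x -> combinations y -> combinations (x + y).
Proof. by move=> hx hy; rewrite -[x]scale1r; apply: combinationsP. Qed.

Lemma combinations_gen j : combinations (b j).
Proof.
exists (delta_mx 0 j); rewrite (bigD1 j) //= mxE !eqxx scale1r big1 ?addr0 //.
by move=> k kj; rewrite mxE (negPf kj) scale0r.
Qed.

Lemma combinations_lspan (S : W -> Prop) x :
  (forall y, S y -> combinations y) -> lspan S x -> combinations x.
Proof.
move=> hS [m [a [f [Sf ->]]]]; apply: big_ind => [||i _]; last 1 first.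
- by rewrite -[_ *: _]addr0; apply: combinationsP combinations0; apply: hS.
- exact: combinations0.
exact: combinationsD.
Qed.

End Combinations.

Lemma wdeg_omega : wdeg omega5 = 41%N.
Proof. by rewrite /wdeg !big_ord_recl big_ord0. Qed.

Lemma low_exps (Y : 'X_{1..5}) : mdeg Y = 41%N ->
  lexlt (weight Y) (wvec omega5) -> low (exps Y).
Proof.
move=> mY wY; have sY := size_exps Y.
have dY : deg41 (exps Y) by apply/deg41P; split=> //; rewrite -(mdeg_mon sY) expsK.
by rewrite /low dY; apply/lowP; rewrite ?expsK.
Qed.

Lemma Phi_sumZ n (c : 'I_n -> 'F_2) (f : 'I_n -> P) :
  Phi (\sum_i c i *: f i) = \sum_i c i *: Phi (f i).
Proof. by rewrite (big_morph Phi PhiD Phi0); apply: eq_bigr => i _; rewrite PhiZ. Qed.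

Lemma Phi_lspan_lt F : lspan (@monoms_lt 5 omega5) F -> Phi F = 0.
Proof.
case=> n [c [f [hf ->]]]; rewrite Phi_sumZ big1 // => i _.
have [Y [-> + wY]] := hf i; rewrite wdeg_omega => mY; rewrite -(expsK Y).
by rewrite Phi_vanish ?scaler0 ?size_exps // low_exps ?orbT.
Qed.

Lemma Phi_rel (D : P_le 5 omega5) : lspan rel_le D -> Phi (val D) = 0.
Proof.
case=> n [c [f [hf ->]]]; rewrite raddf_sum /=.
rewrite Phi_sumZ big1 // => i _; case: (hf i) => [/Phi_hit|/Phi_lspan_lt] ->;
  exact: scaler0.
Qed.

(** The choice of representative is immaterial, since [Phi] vanishes on the relations by
    [Phi_rel]. *)
Definition Psi (x : Q) := Phi (val (repr x)).

Lemma Psi_class F : Psi (quotient_class rel_le F) = Phi (val F).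
Proof.
have /quotient_classP/Phi_rel := quotient_class_repr (quotient_class rel_le F).
rewrite raddfB /= => E; rewrite /Psi -[X in Phi X = _](subrK (val F)) PhiD.
by rewrite E add0r.
Qed.

Lemma Psi_linear c x y : Psi (c *: x + y) = c *: Psi x + Psi y.
Proof.
rewrite -[x]quotient_class_repr -[y]quotient_class_repr.
rewrite -[c *: _]/(quotient_scale _ _) quotient_scaleE -quotient_classD !Psi_class.
by rewrite raddfD /= PhiD PhiZ.
Qed.

Lemma Psi_qclass X : target X -> Psi (qclass 'X_[mon5 X]) = Phi 'X_[mon5 X].
Proof. by move=> tX; rewrite Psi_class pleK // in_le_mon ?tX. Qed.

Lemma pos_qclass X : target X ->
  qclass 'X_[mon5 X] \in in_span (@pos_classes 5 omega5).
Proof.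
move=> tX; apply/in_spanP/lspan_gen; exists (ple 'X_[mon5 X]), (mon5 X).
by split=> //; [rewrite pleK // in_le_mon ?tX | case/targetP: tX].
Qed.

Definition adm_class (j : 'I_N) : Q_weight_pos 5 omega5 :=
  Subspace (pos_qclass (adm_target (adm_nth_mem j))).

(** Monomials are linearly independent: the coefficient at X shows that X must be one of the
    monomials in the combination. *)
Lemma monoms_le_mon X : in_le 'X_[X] ->
  mdeg X = 41%N /\ (lexlt (weight X) (wvec omega5) \/ weight X =1 wvec omega5).
Proof.
case/in_spanP=> n [c [f [hf Xf]]].
have [[i fi]|no] := pselect (exists i, f i = 'X_[X]).
  have [Y [fY + wY]] := hf i; rewrite wdeg_omega.
  have /(congr1 (mcoeff X)) : 'X_[X] = 'X_[Y] :> P by rewrite -fi fY.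
  by rewrite !mcoeffX eqxx; case: eqP => [<-|].
have /eqP : ('X_[X] : P)@_X = 0.
  rewrite Xf raddf_sum big1 // => i _; rewrite /= mcoeffZ.
  have [Y [fY _ _]] := hf i; rewrite fY mcoeffX; case: eqP => [YX|_]; last by rewrite mulr0.
  by case: no; exists i; rewrite fY YX.
by rewrite mcoeffX eqxx oner_eq0.
Qed.

Definition adm_span (x : Q) := combinations (fun j => val (adm_class j)) x.

Lemma adm_span_target X : target X -> adm_span (qclass 'X_[mon5 X]).
Proof.
move=> tX; have [L /allP lL hL] := span_adm tX.
have tL : all (fun Y => target Y || low Y) L.
  by apply/allP=> Y /lL/andP[/adm_target->].
rewrite (@qclass_hit_mod_low _ (msum L)) ?in_le_msum ?in_le_mon ?tX //.
rewrite qclass_msum // big_seq.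
apply: big_ind => [||Y /lL/andP[Ya _]]; [exact: combinations0|exact: combinationsD|].
have [j ->] := adm_index Ya.
exact: (combinations_gen (fun j => val (adm_class j))).
Qed.

(** A positive monomial of weight at most omega is either a target or of lower weight, and then its
    class is zero. *)
Lemma adm_span_pos x : pos_classes x -> adm_span x.
Proof.
case=> F [X [FX pX ->]].
have lX : in_le 'X_[X] by rewrite /in_le -FX; apply: (valP F).
have -> : quotient_class rel_le F = qclass 'X_[X].
  by congr quotient_class; apply: val_inj; rewrite pleK.
have [mX wX] := monoms_le_mon lX; rewrite -(expsK X).
case: wX => [/low_exps-/(_ mX) lowX|wX]; last first.
  by apply: adm_span_target; apply/targetP; rewrite expsK size_exps.
rewrite (@qclass_hit_mod_low _ 0) ?qclass0 ?in_le_mon ?lowX ?orbT //.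
- exact: combinations0.
- by rewrite /in_le rpred0.
exists [:: exps X]; rewrite /= ?lowX // /msum big_seq1 addr0 char2_mpoly.
exact: hit0.
Qed.

Lemma adm_class_span (w : Q_weight_pos 5 omega5) :
  exists c : 'rV_N, w = \sum_j c 0 j *: adm_class j.
Proof.
have [c wc] : adm_span (val w).
  exact: combinations_lspan adm_span_pos (in_spanP _ _ (valP w)).
by exists c; apply: val_inj; rewrite wc raddf_sum.
Qed.

Lemma dim_Q_weight_pos : has_dim (Q_weight_pos 5 omega5) N.
Proof.
apply: (@has_dim_coordinates _ _ adm_class _ (fun w => Psi (val w))).
- by move=> c x y; rewrite linearP Psi_linear.
- exact: adm_class_span.
(* The images of the basis classes under [Psi] are the rows of [adm_matrix]. *)
move=> c; under eq_bigr => j _ do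
  rewrite /= Psi_qclass ?adm_target ?adm_nth_mem // -(rowK (fun j => Phi 'X_[mon5 (adm_nth j)])).
by rewrite -mulmx_sum_row; apply: adm_matrix_inj.
Qed.

Local Close Scope ring_scope.

Theorem theorem2p4 :
  let omega := [:: 3; 3; 2; 1; 1]%N in
  (exists s : seq 'X_{1..5},
     [/\ uniq s, size s = 925%N &
         forall X : 'X_{1..5},
           X \in s <->
           [/\ mdeg X = (5 * (2 ^ 1 - 1) + 18 * 2 ^ 1)%N, positive_monom X,
               weight X =1 wvec omega & admissible X]])
  /\ (5 * (2 ^ 1 - 1) + 18 * 2 ^ 1 = 41)%N /\ wdeg omega = 41%N
  /\ has_dim (Q_weight_pos 5 omega) 925.
Proof.
move=> omega; have d41 : (5 * (2 ^ 1 - 1) + 18 * 2 ^ 1 = 41)%N by [].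
split; last by split=> //; split; [exact: wdeg_omega | rewrite -size_adm; exact: dim_Q_weight_pos].
have sadm X : X \in adm -> size X = 5%N by move/adm_target/size_target.
exists (map mon5 adm); split; last 1 first.
- move=> X; rewrite d41; split=> [/mapP[Y Ya ->]|[mX pX wX aX]].
    by have /targetP[] := adm_target Ya; split=> //; apply: adm_admissible.
  have tX : target (exps X) by apply/targetP; rewrite expsK size_exps.
  rewrite -(expsK X); apply: map_f; apply: contrapT => /negP Xa.
  by apply: aX; rewrite -(expsK X); apply: inadmissible_target.
- rewrite map_inj_in_uniq ?uniq_adm // => X Y /sadm sX /sadm sY.
  exact: mon_inj.
by rewrite size_map size_adm.
Qed.
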